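(* Let $n_k=n-\#\mathcal{J}_k$ for every $k\in[K]$ and $\overline{R}=\sum_{k=1}^K R_k(n_k-R_k)$. An optimal solution of the bilevel problem $$\max_{y\in\mathbb{R}^n}\ \sum_{i=1}^n f_i(N_i)\quad\text{s.t. } N_i\le N_i^C\ \ \forall i\in[n],\qquad N=\sum_{k=1}^K u_k^*,\quad u_k^*\in\arg\max_{u_k\in F_k}\langle \rho_k+y,u_k\rangle\ \ \forall k\in[K],$$ can be obtained in $$O\big((Kn)^{3.5}\,L\,n^3\log^2(K/n)+(n+\overline{R})^{3.5}L\big)$$ arithmetic operations, where $L$ is the input size of the bilevel problem.
   Context: $[m]=\{1,\dots,m\}$. Let $n,K\ge 1$ be integers. For each $k\in[K]$ let $\mathcal{J}_k\subset[n]$, let $R_k$ be a nonnegative integer, and let $\rho_k\in(\mathbb{R}\cup\{-\infty\})^n$ with $\rho_k(i)=-\infty$ if and only if $i\in\mathcal{J}_k$. Set $F_k=\{u\in\{0,1\}^n : \sum_{i=1}^n u(i)=R_k,\ u(i)=0\ \forall i\in\mathcal{J}_k\}$. In scalar products the convention $(-\infty)\cdot 0=0$ is used. For each $i\in[n]$, $N_i^C$ is a nonnegative integer and $f_i(x)=x\,s_i(x)$ with $s_i:\mathbb{R}_+\to\mathbb{R}$ nonincreasing and concave on $[0,N_i^C]$; each $f_i$ can be evaluated at a point in $O(1)$ operations. When lower-level solutions are not unique, the choice of $u_k^*$ is part of the optimization (optimistic formulation). The problem is assumed feasible, i.e. some $N\in\sum_k F_k$ satisfies $N_i\le N_i^C$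 for all $i$. *)

(* Defs.v *)
From mathcomp Require Import all_boot all_order all_algebra.
From mathcomp Require Import boolp classical_sets reals ereal constructive_ereal.
From mathcomp Require Import topology normedtype exp convex.

Set Implicit Arguments.
Unset Strict Implicit.
Unset Printing Implicit Defensive.

Import Order.TTheory GRing.Theory Num.Theory.
Local Open Scope ring_scope.

Section Bilevel.
Context {R : realType} {n K : nat}.
Implicit Types (u : {ffun 'I_n -> bool}) (U : 'I_K -> {ffun 'I_n -> bool}).

(* {0,1}-vectors are boolean vectors, coerced to 0/1 where they are summed. *)
Definition lower_set (J : {set 'I_n}) (r : nat) : pred {ffun 'I_n -> bool} :=
  [pred u : {ffun 'I_n -> bool} |
     ((\sum_(i < n) u i)%N == r) && [forall i in J, ~~ u i]].

(* [-oo * 0 = 0] in [\bar R], which is the convention used in the scalar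
   products with [rho_k + y]. *)
Definition scal (c : 'I_n -> \bar R) u : \bar R :=
  (\sum_(i < n) c i * (u i)%:R%:E)%E.

Definition is_argmax (T : Type) (F : pred T) (phi : T -> \bar R) (x : T) : Prop :=
  F x /\ forall z, F z -> (phi z <= phi x)%E.

Definition load U (i : 'I_n) : nat := (\sum_(k < K) U k i)%N.

(* f_i(x) = x s_i(x) *)
Definition revenue (s : 'I_n -> R -> R) (i : 'I_n) (x : R) : R := x * s i x.

Definition objective (s : 'I_n -> R -> R) U : R :=
  \sum_(i < n) revenue s i (load U i)%:R.

(* Optimistic formulation: the lower-level solutions [U k] are decision
   variables of the upper level, together with [y]. *)
Definition bilevel_feasible (J : 'I_K -> {set 'I_n}) (r : 'I_K -> nat)
    (rho : 'I_K -> 'I_n -> \bar R) (NC : 'I_n -> nat)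
    (y : 'I_n -> R) U : Prop :=
  (forall i, load U i <= NC i)%N /\
  (forall k, is_argmax (lower_set (J k) (r k))
               (scal (fun i => (rho k i + (y i)%:E)%E)) (U k)).

Definition bilevel_optimal (J : 'I_K -> {set 'I_n}) (r : 'I_K -> nat)
    (rho : 'I_K -> 'I_n -> \bar R) (NC : 'I_n -> nat) (s : 'I_n -> R -> R)
    (y : 'I_n -> R) U : Prop :=
  bilevel_feasible J r rho NC y U /\
  forall y' U', bilevel_feasible J r rho NC y' U' ->
    objective s U' <= objective s U.

Definition nfree (J : 'I_K -> {set 'I_n}) (k : 'I_K) : nat := (n - #|J k|)%N.

Definition Rbar (J : 'I_K -> {set 'I_n}) (r : 'I_K -> nat) : nat :=
  (\sum_(k < K) r k * (nfree J k - r k))%N.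

End Bilevel.

Definition nat_size (m : nat) : nat := (trunc_log 2 m).+1.

Definition rat_size (q : rat) : nat :=
  (1 + nat_size `|numq q| + nat_size `|denq q|)%N.

(* An irrational number has no finite binary encoding; as in the real-number
   model of computation it counts as a single symbol.  On rational data the
   size is the usual bit length. *)
Definition real_size (R : realType) (x : R) : nat :=
  match pselect (exists q : rat, ratr q = x) with
  | left ratx => rat_size (projT1 (cid ratx))
  | right _ => 1%N
  end.

Definition ereal_size (R : realType) (x : \bar R) : nat :=
  if x is x'%:E then real_size x' else 1%N.

(* The sets J_k are encoded by the infinite entries of rho_k, and the f_i are
   given by oracles, which do not contribute to the size. *)
Definition input_size (R : realType) (n K : nat) (r : 'I_K -> nat)
    (rho : 'I_K -> 'I_n -> \bar R) (NC : 'I_n -> nat) : nat :=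
  (nat_size n + nat_size K
   + \sum_(k < K) (nat_size (r k) + \sum_(i < n) ereal_size (rho k i))
   + \sum_(i < n) nat_size (NC i))%N.

(* Computation model for counting arithmetic operations:
   a structured real RAM: finitely many (those named in the program) unbounded
   two-dimensional arrays of natural numbers, and likewise of real numbers,
   with exact unit-cost arithmetic and comparisons, indirect addressing and an
   oracle for the functions f_i.  There is no rounding from reals to
   integers.  Programs are finite syntax, so a single program has to serve all
   instances. *)

Inductive iexp : Type :=
| ILit of nat
| IGet of nat & iexp & iexp               (* array, row, column *)
| IAdd of iexp & iexp
| ISub of iexp & iexp                     (* truncated *)
| IMul of iexp & iexp.

Inductive rexp : Type :=
| RNat of iexp
| RGet of nat & iexp & iexp
| RAdd of rexp & rexp
| RSub of rexp & rexp
| RMul of rexp & rexp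
| RDiv of rexp & rexp                     (* x / 0 = 0 *)
| REval of iexp & rexp.                   (* REval i x is f_i(x) *)

Inductive bexp : Type :=
| BILe of iexp & iexp
| BRLe of rexp & rexp
| BNot of bexp
| BAnd of bexp & bexp.

Inductive program : Type :=
| Skip
| ISet of nat & iexp & iexp & iexp        (* array, row, column, value *)
| RSet of nat & iexp & iexp & rexp
| Seq of program & program
| If of bexp & program & program
| While of bexp & program.

Fixpoint icost (e : iexp) : nat :=
  match e with
  | ILit _ => 1%N
  | IGet _ e1 e2 | IAdd e1 e2 | ISub e1 e2 | IMul e1 e2 =>
      (1 + icost e1 + icost e2)%N
  end.

Fixpoint rcost (e : rexp) : nat :=
  match e with
  | RNat e1 => (1 + icost e1)%N
  | RGet _ e1 e2 => (1 + icost e1 + icost e2)%N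
  | RAdd e1 e2 | RSub e1 e2 | RMul e1 e2 | RDiv e1 e2 =>
      (1 + rcost e1 + rcost e2)%N
  | REval e1 e2 => (1 + icost e1 + rcost e2)%N
  end.

Fixpoint bcost (e : bexp) : nat :=
  match e with
  | BILe e1 e2 => (1 + icost e1 + icost e2)%N
  | BRLe e1 e2 => (1 + rcost e1 + rcost e2)%N
  | BNot e1 => (1 + bcost e1)%N
  | BAnd e1 e2 => (1 + bcost e1 + bcost e2)%N
  end.

Section Semantics.
Variables (R : realType) (orc : nat -> R -> R).

Record memory : Type := Memory {
  imem : nat -> nat -> nat -> nat;
  rmem : nat -> nat -> nat -> R
}.

Definition upd (T : Type) (g : nat -> nat -> nat -> T) (a i j : nat) (v : T) :=
  fun a' i' j' =>
    if [&& a' == a, i' == i & j' == j] then v else g a' i' j'.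

Fixpoint ieval (m : memory) (e : iexp) : nat :=
  match e with
  | ILit c => c
  | IGet a e1 e2 => imem m a (ieval m e1) (ieval m e2)
  | IAdd e1 e2 => (ieval m e1 + ieval m e2)%N
  | ISub e1 e2 => (ieval m e1 - ieval m e2)%N
  | IMul e1 e2 => (ieval m e1 * ieval m e2)%N
  end.

Fixpoint reval (m : memory) (e : rexp) : R :=
  match e with
  | RNat e1 => (ieval m e1)%:R
  | RGet a e1 e2 => rmem m a (ieval m e1) (ieval m e2)
  | RAdd e1 e2 => reval m e1 + reval m e2
  | RSub e1 e2 => reval m e1 - reval m e2
  | RMul e1 e2 => reval m e1 * reval m e2
  | RDiv e1 e2 => reval m e1 / reval m e2
  | REval e1 e2 => orc (ieval m e1) (reval m e2)
  end.

Fixpoint beval (m : memory) (e : bexp) : bool :=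
  match e with
  | BILe e1 e2 => (ieval m e1 <= ieval m e2)%N
  | BRLe e1 e2 => reval m e1 <= reval m e2
  | BNot e1 => ~~ beval m e1
  | BAnd e1 e2 => beval m e1 && beval m e2
  end.

(* [exec P m t m']: started in [m], [P] halts in [m'] after [t] operations. *)
Inductive exec : program -> memory -> nat -> memory -> Prop :=
| exec_Skip m : exec Skip m 1%N m
| exec_ISet a e1 e2 e m :
    exec (ISet a e1 e2 e) m (1 + icost e1 + icost e2 + icost e)%N
      (Memory (upd (imem m) a (ieval m e1) (ieval m e2) (ieval m e)) (rmem m))
| exec_RSet a e1 e2 e m :
    exec (RSet a e1 e2 e) m (1 + icost e1 + icost e2 + rcost e)%N
      (Memory (imem m) (upd (rmem m) a (ieval m e1) (ieval m e2) (reval m e)))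
| exec_Seq P Q m1 t1 m2 t2 m3 :
    exec P m1 t1 m2 -> exec Q m2 t2 m3 -> exec (Seq P Q) m1 (t1 + t2)%N m3
| exec_If b P Q m t m' :
    exec (if beval m b then P else Q) m t m' ->
    exec (If b P Q) m (1 + bcost b + t)%N m'
| exec_WhileF b P m :
    ~~ beval m b -> exec (While b P) m (1 + bcost b)%N m
| exec_WhileT b P m1 t1 m2 t2 m3 :
    beval m1 b -> exec P m1 t1 m2 -> exec (While b P) m2 t2 m3 ->
    exec (While b P) m1 (1 + bcost b + t1 + t2)%N m3.

End Semantics.

Definition ext1 (T : Type) (x0 : T) (p : nat) (g : 'I_p -> T) (i : nat) : T :=
  oapp g x0 (insub i).

Definition ext2 (T : Type) (x0 : T) (p q : nat) (g : 'I_p -> 'I_q -> T)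
    (i j : nat) : T :=
  ext1 x0 (fun i' => ext1 x0 (g i') j) i.

Definition column (T : Type) (x0 : T) (g : nat -> T) (i j : nat) : T :=
  if j == 0%N then g i else x0.

(* The f_i are functions on the nonnegative reals; outside their domain the
   oracle returns 0. *)
Definition oracle (R : realType) (n : nat) (s : 'I_n -> R -> R)
    (i : nat) (x : R) : R :=
  if 0 <= x then ext1 0 (fun i' => revenue s i' x) i else 0.

(* Integer arrays 0-3 hold (n, K), R, N^C and the indicator of J; real array 0
   holds rho, with 0 in place of -oo.  All other cells are initially 0. *)
Definition input_memory (R : realType) (n K : nat) (J : 'I_K -> {set 'I_n})
    (r : 'I_K -> nat) (rho : 'I_K -> 'I_n -> \bar R) (NC : 'I_n -> nat) :
    memory R :=
  Memory
    (fun a => match a with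
              | 0%N => column 0%N (nth 0%N [:: n; K])
              | 1%N => column 0%N (ext1 0%N r)
              | 2%N => column 0%N (ext1 0%N NC)
              | 3%N => ext2 0%N (fun k i => nat_of_bool (i \in J k))
              | _ => fun _ _ => 0%N
              end)
    (fun a => match a with
              | 0%N => ext2 0 (fun k i => fine (rho k i))
              | _ => fun _ _ => 0
              end).

(* A solution is returned in real array 1 (y) and integer array 4 (u). *)
Definition outputs (R : realType) (n K : nat) (m : memory R)
    (y : 'I_n -> R) (U : 'I_K -> {ffun 'I_n -> bool}) : Prop :=
  (forall i : 'I_n, rmem m 1%N i 0%N = y i) /\
  (forall (k : 'I_K) (i : 'I_n), imem m 4%N k i = U k i :> nat).

(* Main.v *)
Require Import Defs.
From mathcomp Require Import all_boot all_order all_algebra.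
From mathcomp Require Import boolp classical_sets reals ereal constructive_ereal.
From mathcomp Require Import topology normedtype exp convex.
From mathcomp Require Import zify ring lra.

(* Every load vector N in the sum of the F_k is induced by some price vector y:
   multipliers of the transportation problem "maximize the sum of the
   <rho_k, u_k> subject to sum_k u_k = N" make every u_k a best response.  So
   the upper level maximizes the separable function sum_i f_i(N_i), which is
   concave because f_i(x) = x s_i(x), over all attainable loads; then one
   transportation problem for the optimal loads yields y and the u_k.

   Both problems are solved by the same primal-dual (Hungarian) method: first
   with costs 0, revenues f_i and bounds N^C, then with costs rho, no revenues
   and the optimal loads as bounds.  It keeps prices q and partial row choices u
   such that each row holds items of largest cost plus price and q_i lies
   between the marginal revenues at N_i and N_i - 1.  To add an item to a row,
   an alternating tree is grown; each step lowers the prices in the tree by the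
   smallest slack and then reaches a new item or one with room left, so that at
   most n+1 scans of the K n^2 exchanges suffice.

   Rows with R_k = 0 or R_k = n_k are settled in advance, and any other row
   needs R_k <= R_k (n_k - R_k) augmentations.  The running time is thus
   O(K n (n + Rbar)^3), and L >= K n, so that the second summand of the bound
   is enough. *)

Set Implicit Arguments.
Unset Strict Implicit.
Unset Printing Implicit Defensive.

Import Order.TTheory GRing.Theory Num.Theory.
Local Open Scope ring_scope.

(** * A Hoare logic with time bounds for the real RAM *)

Fixpoint iwrites (P : program) : seq nat :=
  match P with
  | Skip | RSet _ _ _ _ => [::]
  | ISet a _ _ _ => [:: a]
  | Seq P Q | If _ P Q => iwrites P ++ iwrites Q
  | While _ P => iwrites P
  end.

Fixpoint rwrites (P : program) : seq nat :=
  match P with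
  | Skip | ISet _ _ _ _ => [::]
  | RSet a _ _ _ => [:: a]
  | Seq P Q | If _ P Q => rwrites P ++ rwrites Q
  | While _ P => rwrites P
  end.

Definition var (a : nat) : iexp := IGet a (ILit 0) (ILit 0).
Definition setvar (a : nat) (e : iexp) : program := ISet a (ILit 0) (ILit 0) e.
Definition ILt (e1 e2 : iexp) : bexp := BILe (IAdd e1 (ILit 1)) e2.
Definition for_loop (v : nat) (b : iexp) (P : program) : program :=
  Seq (setvar v (ILit 0))
      (While (ILt (var v) b) (Seq P (setvar v (IAdd (var v) (ILit 1))))).

Section Hoare.
Variables (R : realType) (orc : nat -> R -> R).
Implicit Types (m : memory R) (P : program) (Q : memory R -> Prop).

(** The effect of assigning a loop counter; the rule for loops states its invariant in this memory,
    after the increment. *)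
Definition ivar_set m (a x : nat) : memory R :=
  Memory (upd (imem m) a 0%N 0%N x) (rmem m).

Definition run P m (T : nat) Q : Prop :=
  exists t m', [/\ exec orc P m t m', (t <= T)%N & Q m'].

(** The frame is syntactic and by whole arrays, so that the survival of an array is decided by
    computation on [P]. *)
Definition frame P m m' : Prop :=
  (forall a, a \notin iwrites P -> imem m' a = imem m a) /\
  (forall a, a \notin rwrites P -> rmem m' a = rmem m a).

Lemma upd_neq (T : Type) (g : nat -> nat -> nat -> T) a i j v a' :
  a' != a -> upd g a i j v a' = g a'.
Proof.
by move=> /negbTE ne; apply/funext => i'; apply/funext => j'; rewrite /upd ne.
Qed.

Lemma exec_frame P m t m' : exec orc P m t m' -> frame P m m'.
Proof.
elim=> {P m t m'} //=.
- by move=> a e1 e2 e m; split=> //= b; rewrite inE; exact: upd_neq.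
- by move=> a e1 e2 e m; split=> //= b; rewrite inE; exact: upd_neq.
- move=> P Q m1 t1 m2 t2 m3 _ [h1 h2] _ [h3 h4]; split=> a;
    rewrite /= mem_cat negb_or => /andP[aP aQ].
  + by rewrite h3 ?h1.
  + by rewrite h4 ?h2.
- move=> b P Q m t m' _; case: ifP => _ [h1 h2]; split=> a;
    rewrite /= mem_cat negb_or => /andP[aP aQ];
    by [apply: h1|apply: h2].
- move=> b P m1 t1 m2 t2 m3 _ _ [h1 h2] _ [h3 h4]; split=> a aP.
  + by rewrite h3 ?h1.
  + by rewrite h4 ?h2.
Qed.

Lemma run_frame P m T Q :
  run P m T Q -> run P m T (fun m' => frame P m m' /\ Q m').
Proof.
move=> [t [m' [e le_t Qm]]]; exists t, m'; split=> //.
by split=> //; apply: exec_frame e.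
Qed.

Lemma run_le P m T T' Q : run P m T Q -> (T <= T')%N -> run P m T' Q.
Proof.
move=> [t [m' [e le_t Qm]]] le_T; exists t, m'; split=> //.
exact: leq_trans le_T.
Qed.

Lemma run_impl P m T Q Q' :
  run P m T Q -> (forall m', frame P m m' -> Q m' -> Q' m') -> run P m T Q'.
Proof.
move=> /run_frame[t [m' [e le_t [F Qm]]]] QQ'; exists t, m'; split=> //.
exact: QQ'.
Qed.

Lemma run_skip m Q : Q m -> run Skip m 1 Q.
Proof. by move=> Qm; exists 1%N, m; split=> //; constructor. Qed.

Lemma run_iset a e1 e2 e m Q :
  Q (Memory (upd (imem m) a (ieval m e1) (ieval m e2) (ieval m e)) (rmem m)) ->
  run (ISet a e1 e2 e) m (1 + icost e1 + icost e2 + icost e) Q.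
Proof. by move=> Qm; eexists _, _; split; [constructor|exact: leqnn|]. Qed.

Lemma run_rset a e1 e2 e m Q :
  Q (Memory (imem m)
       (upd (rmem m) a (ieval m e1) (ieval m e2) (reval orc m e))) ->
  run (RSet a e1 e2 e) m (1 + icost e1 + icost e2 + rcost e) Q.
Proof. by move=> Qm; eexists _, _; split; [constructor|exact: leqnn|]. Qed.

Lemma run_seq P1 P2 m T1 T2 Q :
  run P1 m T1 (fun m' => run P2 m' T2 Q) -> run (Seq P1 P2) m (T1 + T2) Q.
Proof.
move=> [t1 [m1 [e1 le1 [t2 [m2 [e2 le2 Qm]]]]]].
by exists (t1 + t2)%N, m2; split=> //; [exact: exec_Seq e1 e2|exact: leq_add].
Qed.

(** The budgets of the branches are added rather than maximised, which keeps the bounds linear. *)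
Lemma run_if b P1 P2 m T1 T2 Q :
  (beval orc m b -> run P1 m T1 Q) -> (~~ beval orc m b -> run P2 m T2 Q) ->
  run (If b P1 P2) m (1 + bcost b + (T1 + T2)) Q.
Proof.
case: (boolP (beval orc m b)) => [bm /(_ isT) H _|bm _ /(_ isT) H].
- have [t [m' [e le_t Qm]]] := H.
  exists (1 + bcost b + t)%N, m'; split=> //; last by lia.
  by apply: exec_If; rewrite bm.
- have [t [m' [e le_t Qm]]] := H.
  exists (1 + bcost b + t)%N, m'; split=> //; last by lia.
  by apply: exec_If; rewrite (negbTE bm).
Qed.

(** The index of [I] is a ghost counter that grows by one per iteration and is below [M] whenever
    the guard holds, hence at most [M - x] iterations. The frame from the start is handed to the
    step, so that [I] need not mention what the body leaves alone. *)
Lemma run_while b P (I : nat -> memory R -> Prop) (M : nat) (T : nat) x m :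
  (forall y m', (x <= y)%N -> frame P m m' -> I y m' -> beval orc m' b ->
     (y < M)%N /\ run P m' T (I y.+1)) ->
  I x m ->
  run (While b P) m ((M - x) * (1 + bcost b + T) + (1 + bcost b))
      (fun m' => (exists y, I y m') /\ ~~ beval orc m' b).
Proof.
move=> step.
suff loop d x1 m1 : (M - x1)%N = d -> frame P m m1 -> (x <= x1)%N -> I x1 m1 ->
    run (While b P) m1 (d * (1 + bcost b + T) + (1 + bcost b))
      (fun m' => (exists y, I y m') /\ ~~ beval orc m' b).
  by apply: loop.
elim: d x1 m1 => [|d IH] x1 m1 dE Fm le_x Im.
  case: (boolP (beval orc m1 b)) => bm.
    by have [] := step _ _ le_x Fm Im bm; lia.
  eexists _, m1; split; [exact: exec_WhileF|by lia|].
  by split=> //; exists x1.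
case: (boolP (beval orc m1 b)) => bm; last first.
  eexists _, m1; split; [exact: exec_WhileF|by lia|].
  by split=> //; exists x1.
have [lt_M /run_frame[t1 [m2 [e1 le1 [F2 I2]]]]] := step _ _ le_x Fm Im bm.
have Fm2 : frame P m m2.
  case: Fm F2 => h1 h2 [h3 h4]; split=> a aP.
  - by rewrite h3 ?h1.
  - by rewrite h4 ?h2.
have [||t2 [m3 [e2 le2 Q3]]] := IH x1.+1 m2 _ Fm2 _ I2; [lia|exact: leqW|].
exists (1 + bcost b + t1 + t2)%N, m3; split=> //; first exact: exec_WhileT e1 e2.
by rewrite mulSn; lia.
Qed.

(** Each round pays [7 + icost b] for the guard and 8 for the increment; the first assignment and
    the last guard fit into [12 + icost b]. *)
Lemma run_for (v : nat) b P (I : nat -> memory R -> Prop) (T : nat -> nat) x m :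
  v \notin iwrites P ->
  (forall m', frame (for_loop v b P) m m' -> ieval m' b = x) ->
  I 0%N (ivar_set m v 0) ->
  (forall y m', (y < x)%N -> frame (for_loop v b P) m m' ->
     imem m' v 0%N 0%N = y -> I y m' ->
     run P m' (T y) (fun m'' => I y.+1 (ivar_set m'' v y.+1))) ->
  run (for_loop v b P) m
      ((\sum_(y < x) T y) + x * (15 + icost b) + (12 + icost b)) (I x).
Proof.
move=> vP bE I0 step; set L := for_loop v b P.
have Fivar m1 y : frame L m m1 -> frame L m (ivar_set m1 v y).
  move=> [h1 h2]; split=> a aL /=; last exact: h2.
  rewrite upd_neq ?h1 //; apply: contraNneq aL => ->.
  by rewrite /= inE eqxx.
suff loop d y m1 : (y + d = x)%N -> frame L m m1 -> imem m1 v 0%N 0%N = y ->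
    I y m1 ->
    run (While (ILt (var v) b) (Seq P (setvar v (IAdd (var v) (ILit 1))))) m1
     ((\sum_(y <= z < x) T z) + d * (15 + icost b) + (7 + icost b)) (I x).
  apply: run_le.
    apply: run_seq; apply: run_iset => /=; apply: (loop x 0%N) => //.
    - exact: (Fivar m).
    - by rewrite /= /upd !eqxx.
  rewrite /= big_mkord; move: (\sum_(_ < x) _)%N (x * _)%N => S X; lia.
elim: d y m1 => [|d IH] y m1 yE F1 vE Iy.
  rewrite addn0 in yE; exists (7 + icost b)%N, m1; split.
  - have -> : (7 + icost b = 1 + bcost (ILt (var v) b))%N by [].
    by apply: exec_WhileF => /=; rewrite vE bE // yE addn1 ltnn.
  - by rewrite leq_addl.
  - by rewrite -yE.
have lt_y : (y < x)%N by lia.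
have [t [m2 [e2 le2 [F2 I2]]]] := run_frame (step y m1 lt_y F1 vE Iy).
have v2 : imem m2 v 0%N 0%N = y by rewrite F2.1.
have F3 : frame L m m2.
  case: F1 F2 => h1 h2 [h3 h4]; split=> a aL.
  - rewrite h3 ?h1 //; apply: contra aL => aP.
    by rewrite /= inE mem_cat aP orbT.
  - rewrite h4 ?h2 //; apply: contra aL => aP.
    by rewrite /= mem_cat aP.
have [||||t4 [m4 [e4 le4 Q4]]] := IH y.+1 (ivar_set m2 v y.+1).
- by rewrite addSnnS.
- exact: Fivar.
- by rewrite /= /upd !eqxx.
- exact: I2.
eexists _, m4; split; last exact: Q4.
- apply: exec_WhileT; [|apply: exec_Seq; [exact: e2|apply: exec_ISet]|].
    by rewrite /= vE bE // addn1.
  by rewrite /= v2 addn1; exact: e4.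
- rewrite /= big_ltn // mulSn; move: le2 le4.
  move: (\sum_(_ <= _ < x) _)%N (d * _)%N => S X; lia.
Qed.

Lemma run_for_const (v : nat) b P (I : nat -> memory R -> Prop) (T : nat) x m :
  v \notin iwrites P ->
  (forall m', frame (for_loop v b P) m m' -> ieval m' b = x) ->
  I 0%N (ivar_set m v 0) ->
  (forall y m', (y < x)%N -> frame (for_loop v b P) m m' ->
     imem m' v 0%N 0%N = y -> I y m' ->
     run P m' T (fun m'' => I y.+1 (ivar_set m'' v y.+1))) ->
  run (for_loop v b P) m (x * (T + (15 + icost b)) + (12 + icost b)) (I x).
Proof.
move=> vP bE I0 step; have := run_for vP bE I0 step.
by rewrite sum_nat_const card_ord -mulnDr.
Qed.

End Hoare.

(** * Optimality conditions and alternating trees *)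

Lemma sum_update (p : nat) (F : nat -> nat) (i v : nat) : (i < p)%N ->
  (\sum_(j < p) (if j == i :> nat then v else F j) + F i =
   \sum_(j < p) F j + v)%N.
Proof.
move=> lt_i; pose i' := Ordinal lt_i.
rewrite (bigD1 i') //= [in RHS](bigD1 i') //= eqxx.
rewrite (eq_bigr (fun j : 'I_p => F j)); first by lia.
by move=> j; rewrite -val_eqE /= => /negbTE ->.
Qed.

Section Assignment.
Variables (R : realType) (n K : nat) (J : nat -> nat -> nat) (r B : nat -> nat).
Variables (c mu : nat -> nat -> R).
Implicit Types (u : nat -> nat -> nat) (q : nat -> R) (N S pi pk : nat -> nat).

(* Item [n] is a dummy that any row may hold but none may acquire: giving a row
   one more item becomes an exchange against the dummy. *)
Definition allowed u : Prop :=
  forall k j, (k < K)%N -> (j <= n)%N ->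
    (u k j <= 1)%N /\ ((j < n)%N -> (0 < u k j)%N -> J k j = 0%N).

(** Complementary slackness inside the rows: no exchange of a held item for an allowed missing one
    gains. The dummy may be given up ([i <= n]) but not taken in ([j < n]). *)
Definition priced u q : Prop :=
  forall k i j, (k < K)%N -> (i <= n)%N -> (j < n)%N ->
    (0 < u k i)%N -> u k j = 0%N -> J k j = 0%N -> c k j + q j <= c k i + q i.

(** With [mu j x] the marginal revenue from [x] to [x + 1], this makes [q j] a supergradient of the
    revenue at [N j], one-sided at the ends 0 and [B j]. *)
Definition balanced N q : Prop :=
  forall j, (j < n)%N -> [/\ (N j <= B j)%N,
    (N j < B j)%N -> mu j (N j) <= q j & (0 < N j)%N -> q j <= mu j (N j).-1].

(** [S] stamps items in the order in which they are reached, 0 meaning unreached. Item [j] was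
    reached by a tight exchange against its parent [pi j] in row [pk j]; stamps decrease towards the
    root, so that paths end. *)
Definition link u q S pi pk (j : nat) : Prop :=
  [/\ (pi j <= n)%N, (pk j < K)%N, (0 < S (pi j) < S j)%N,
      [/\ (0 < u (pk j) (pi j))%N, u (pk j) j = 0%N & J (pk j) j = 0%N]
    & c (pk j) j + q j = c (pk j) (pi j) + q (pi j)].

Definition tree u q S pi pk : Prop :=
  (0 < S n)%N /\ forall j, (j < n)%N -> (0 < S j)%N -> link u q S pi pk j.

Definition feasible_rows u : Prop :=
  [/\ forall k j, (k < K)%N -> (j < n)%N ->
        (u k j <= 1)%N /\ ((0 < u k j)%N -> J k j = 0%N),
      forall k, (k < K)%N -> (\sum_(j < n) u k j)%N = r k
    & forall j, (j < n)%N -> (\sum_(k < K) u k j <= B j)%N].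

Definition swap u (k i j : nat) : nat -> nat -> nat := fun k' j' =>
  if (k' == k) && (j' == j) then 1%N
  else if (k' == k) && (j' == i) then 0%N else u k' j'.

(* The two ways in which a search can proceed: an item that has room left, or
   an exchange in some row between a reached and an unreached item. *)
Definition cand : Type := nat + nat * nat * nat.

Definition is_cand u N S (x : cand) : Prop :=
  match x with
  | inl j => [/\ (j < n)%N, (0 < S j)%N & (N j < B j)%N]
  | inr (k, i, j) =>
      [/\ (k < K)%N, (i <= n)%N & (j < n)%N] /\
      [/\ (0 < S i)%N, (0 < u k i)%N, S j = 0%N, u k j = 0%N & J k j = 0%N]
  end.

(** How far the prices of reached items can fall before the candidate becomes tight. *)
Definition cand_slack q N (x : cand) : R :=
  match x with
  | inl j => q j - mu j (N j)
  | inr (k, i, j) => (c k i + q i) - (c k j + q j)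
  end.

Definition lower S q (d : R) : nat -> R :=
  fun j => if (0 < S j)%N && (j <= n)%N then q j - d else q j.

Lemma cand_slack_ge0 u q N S x :
  priced u q -> balanced N q -> is_cand u N S x -> 0 <= cand_slack q N x.
Proof.
move=> pr ba; case: x => [j [lt_j _ ltB]|[[k i] j] [[lt_k le_i lt_j]]] /=.
  by have [_ /(_ ltB) h _] := ba j lt_j; rewrite subr_ge0.
by move=> [_ ui _ uj Jj]; rewrite subr_ge0; apply: pr.
Qed.

(* Otherwise the reached items would violate the cut condition: they are all
   saturated, and the rows that touch them already use every item they can
   outside. *)
Lemma cand_exists u N S k0 w :
  allowed u -> (k0 < K)%N -> (0 < S n)%N -> u k0 n = 1%N ->
  (forall j, (j < n)%N -> N j = (\sum_(k < K) u k j)%N) ->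
  (forall j, (j < n)%N -> (N j <= B j)%N) ->
  (forall k, (k < K)%N -> (\sum_(j < n) u k j <= r k)%N) ->
  (\sum_(j < n) u k0 j < r k0)%N ->
  feasible_rows w ->
  ~ (forall x, ~ is_cand u N S x).
Proof.
move=> al lt_k0 Sn uk0 NE NB rowle rowlt [wal wrow wcol] nocand.
set T := fun j : 'I_n => (0 < S j)%N.
(* Row [k0] gives the strict inequality: it holds the dummy, which is reached, and is still short of
   an item. *)
have rowT (k : 'I_K) :
    (\sum_(j < n | T j) u k j + (k == k0 :> nat) <= \sum_(j < n | T j) w k j)%N.
  have [/existsP[i /andP[Si ui]]|/existsPn none] :=
      boolP [exists i : 'I_n.+1, (0 < S i)%N && (0 < u k i)%N]; last first.
    have ne : (k == k0 :> nat) = false.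
      apply/negbTE/eqP => kE; have := none ord_max.
      by rewrite /= Sn kE uk0.
    rewrite ne addn0 big1 // => j; rewrite /T => Sj.
    by have := none (widen_ord (leqnSn n) j); rewrite /= Sj -eqn0Ngt => /eqP.
  have out : (\sum_(j < n | ~~ T j) w k j <= \sum_(j < n | ~~ T j) u k j)%N.
    apply: leq_sum => j; rewrite /T -eqn0Ngt => /eqP Sj.
    have [wle wJ] := wal k j (ltn_ord k) (ltn_ord j).
    have := nocand (inr (k : nat, i : nat, j : nat)) => /=.
    case: (posnP (w k j)) => [-> //|wpos].
    case: (posnP (u k j)) => [uj|upos]; last by lia.
    case; split; first by rewrite !ltn_ord -ltnS ltn_ord.
    by split=> //; apply: wJ.
  have := wrow k (ltn_ord k); rewrite (bigID T) => wE.
  have := rowle k (ltn_ord k); rewrite (bigID T) => uE.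
  have [kE|_] := eqVneq (k : nat) k0.
    by move: rowlt; rewrite -kE (bigID T) -wE; move: out; rewrite /=; lia.
  by move: uE; rewrite -wE; move: out; rewrite /=; lia.
have colT : (\sum_(j < n | T j) \sum_(k < K) w k j <=
             \sum_(j < n | T j) \sum_(k < K) u k j)%N.
  apply: leq_sum => j /= Sj; apply: leq_trans (wcol j (ltn_ord j)) _.
  rewrite -NE // leqNgt; apply/negP => NltB.
  by apply: (nocand (inl (j : nat))).
have : (\sum_(k < K) (\sum_(j < n | T j) u k j + (k == k0 :> nat)) <=
        \sum_(k < K) \sum_(j < n | T j) w k j)%N by apply: leq_sum.
rewrite big_split /= exchange_big /= [leqRHS]exchange_big /=.
suff -> : (\sum_(k < K) (k == k0 :> nat) = 1)%N.
  by move=> h; have := leq_trans h colT; rewrite /= addn1 ltnn.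
rewrite (bigD1 (Ordinal lt_k0)) //= eqxx big1 ?addn0 // => k.
by rewrite -val_eqE /= => /negbTE ->.
Qed.

(** * Lowering the prices of the reached items *)

Section Lower.
Variables (u : nat -> nat -> nat) (N S pi pk : nat -> nat) (q : nat -> R).
Variable d : R.
Hypotheses (d_ge0 : 0 <= d)
  (d_le : forall x, is_cand u N S x -> d <= cand_slack q N x).

(** Only an exchange from a reached [i] to an unreached [j] can suffer, and such an exchange is a
    candidate, so its slack is at least [d]. *)
Lemma priced_lower : priced u q -> priced u (lower S q d).
Proof.
move=> pr k i j lt_k le_i lt_j ui uj Jj; rewrite /lower le_i (ltnW lt_j) !andbT.
have h0 := d_ge0; have le_cq := pr k i j lt_k le_i lt_j ui uj Jj.
case: (posnP (S i)) => Si; case: (posnP (S j)) => Sj //=; try lra.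
have /= := d_le (x := inr (k, i, j)) (conj (And3 lt_k le_i lt_j) (And5 Si ui Sj uj Jj)).
by lra.
Qed.

(** Falling prices threaten only the lower bound, which is imposed on items with room left; the
    reached ones among these are candidates. *)
Lemma balanced_lower : balanced N q -> balanced N (lower S q d).
Proof.
move=> ba j lt_j; have [h1 h2 h3] := ba j lt_j.
rewrite /lower (ltnW lt_j) andbT; case: (posnP (S j)) => Sj //=.
split=> // [ltB|Npos].
  by have /= dj := d_le (x := inl j) (And3 lt_j Sj ltB); lra.
by have := h3 Npos; move: d_ge0 => h0 hq; lra.
Qed.

(** Both ends of a link are reached and fall by the same amount, so the link stays tight. *)
Lemma tree_lower : tree u q S pi pk -> tree u (lower S q d) S pi pk.
Proof.
move=> [Sn tr]; split=> // j lt_j Sj; have [h1 h2 /andP[Spi lt_S] h3 h4] := tr j lt_j Sj.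
split=> //; first by rewrite Spi.
by rewrite /lower Sj Spi h1 (ltnW lt_j) /=; lra.
Qed.

End Lower.

Lemma tree_add u N q S pi pk k i j s :
  tree u q S pi pk -> is_cand u N S (inr (k, i, j)) ->
  c k j + q j = c k i + q i ->
  (forall j', (j' <= n)%N -> (S j' <= s)%N) ->
  tree u q (fun x => if x == j then s.+1 else S x)
    (fun x => if x == j then i else pi x) (fun x => if x == j then k else pk x).
Proof.
move=> [Sn tr] [[lt_k le_i lt_j] [Si ui Sj uj Jj]] tight Sle.
split; first by case: eqP.
move=> x lt_x; rewrite /link; case: (eqVneq x j) => [-> _|ne_x Sx].
  have -> : (i == j) = false by apply/negbTE/eqP => E; rewrite E Sj in Si.
  by split=> //; rewrite Si ltnS Sle.
have [h1 h2 /andP[Spi lt_S] h3 h4] := tr x lt_x Sx.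
have -> : (pi x == j) = false.
  by apply/negbTE/eqP => E; rewrite E Sj in Spi.
by split=> //; rewrite Spi.
Qed.

(** The price equals the marginal revenue of the unit being added, which becomes the last unit;
    concavity bounds the next one. *)
Lemma balanced_incr N q b :
  (forall j x, (j < n)%N -> (x.+1 < B j)%N -> mu j x.+1 <= mu j x) ->
  balanced N q -> (b < n)%N -> (N b < B b)%N -> q b = mu b (N b) ->
  balanced (fun j => if j == b then (N j).+1 else N j) q.
Proof.
move=> conc ba lt_b NB qE j lt_j; case: (eqVneq j b) => [->|_]; last exact: ba.
by split=> //= [lt_B|_]; rewrite qE ?lexx // conc.
Qed.

(** * Exchanges along the links of a tree *)

Section Swap.
Variables (u : nat -> nat -> nat) (q : nat -> R) (S pi pk : nat -> nat).
Variable j : nat.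
Hypotheses (lt_j : (j < n)%N) (jlink : link u q S pi pk j).
Let i := pi j.
Let k := pk j.
Let u' := swap u k i j.

Lemma link_neq : i != j.
Proof.
have [_ _ _ [ui uj _] _] := jlink.
by apply/eqP => E; move: ui; rewrite -/i E uj.
Qed.

Lemma allowed_swap : allowed u -> allowed u'.
Proof.
have [_ _ _ [_ _ Jj] _] := jlink.
move=> al k' x lt_k le_x; have [h1 h2] := al k' x lt_k le_x.
rewrite /u' /swap; case: andP => [[/eqP-> /eqP->]|_] //.
by case: ifP.
Qed.

(** By tightness [i] and [j] have the same cost plus price, so each new comparison reduces to an old
    one. *)
Lemma priced_swap : priced u q -> priced u' q.
Proof.
have [le_i lt_k _ [ui uj Jj] tight] := jlink.
move=> pr k' x y lt_k' le_x lt_y; rewrite /u' /swap.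
case: (eqVneq k' k) => [-> /=|_]; last exact: pr.
have xi := pr k x j lt_k le_x lt_j.
have iy := pr k i y lt_k le_i lt_y ui.
have xy := pr k x y lt_k le_x lt_y.
have ty : c k j + q j = c k i + q i by [].
case: (eqVneq x j) => [->|_]; case: (eqVneq y j) => [->|_] //=.
  by case: (eqVneq y i) => [-> _ _ _|_ _ uy Jy]; rewrite ?ty // ?iy.
case: (eqVneq x i) => [//|_]; case: (eqVneq y i) => [-> ux _ _|_]; last exact: xy.
by rewrite -ty; apply: xi.
Qed.

Lemma row_swap k' : allowed u ->
  (\sum_(x < n.+1) u' k' x = \sum_(x < n.+1) u k' x)%N.
Proof.
have [le_i lt_k _ [ui uj Jj] _] := jlink => al.
rewrite /u' /swap; case: (eqVneq k' k) => [->|_] /=; last by [].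
have h1 := sum_update (fun x => if x == i then 0%N else u k x) 1 (leqW lt_j).
have h2 := sum_update (u k) 0 (i := i) (p := n.+1) le_i.
have ui1 : u k i = 1%N.
  by have [le1 _] := al k i lt_k le_i; apply/eqP; rewrite eqn_leq le1 ui.
by move: h1 h2; rewrite /= eq_sym (negbTE link_neq) uj addn0 ui1 => ->; lia.
Qed.

(** In this additive form the unit still to be accounted for passes from [j] to its parent [i]. *)
Lemma col_swap x : allowed u ->
  (\sum_(y < K) u' y x + (x == i) = \sum_(y < K) u y x + (x == j))%N.
Proof.
have [le_i lt_k _ [ui uj Jj] _] := jlink => al.
have ui1 : u k i = 1%N.
  by have [le1 _] := al k i lt_k le_i; apply/eqP; rewrite eqn_leq le1 ui.
rewrite /u' /swap; case: (eqVneq x j) => [->|nej]; rewrite ?andbF ?andbT /=.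
  have := sum_update (u^~ j) 1 lt_k; rewrite uj addn0 => <-.
  rewrite eq_sym (negbTE link_neq) addn0.
  by apply: eq_bigr => y _; rewrite andbT andbF.
case: (eqVneq x i) => [->|nei].
  have := sum_update (u^~ i) 0 lt_k; rewrite -/k ui1 => <-.
  by congr addn; apply: eq_bigr => y _; rewrite andbT andbF.
by congr addn; apply: eq_bigr => y _; rewrite !andbF.
Qed.

(** The parent of [x] has a stamp below that of [i], so it is neither [i] nor [j], and [x] is not
    [j]. If [x] is [i], the exchange only empties a cell, which the link tolerates. *)
Lemma link_swap x : (x < n)%N -> (S x <= S i)%N -> link u q S pi pk x ->
  link u' q S pi pk x.
Proof.
have [le_i lt_k /andP[Si lt_S] [ui uj Jj] tight] := jlink.
move=> lt_x le_S [h1 h2 h3 [ux u0 Jx] h5]; split=> //.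
have [Sp ltp] := andP h3.
have ne1 : pi x != i by apply: contraTneq ltp => ->; rewrite -leqNgt.
have ne2 : pi x != j.
  by apply: contraTneq ltp => ->; rewrite -leqNgt; apply: leq_trans le_S (ltnW _).
have ne3 : x != j by apply: contraTneq le_S => ->; rewrite -ltnNge.
rewrite /u' /swap (negbTE ne1) (negbTE ne2) (negbTE ne3) !andbF; split=> //.
by case: ifP.
Qed.
End Swap.

(** * Prices certify optimality *)

Lemma priced_le u q k w : priced u q -> (k < K)%N ->
  (forall j, (j < n)%N -> (u k j <= 1)%N /\ (w j <= 1)%N) ->
  (forall j, (j < n)%N -> (0 < w j)%N -> J k j = 0%N) ->
  (\sum_(j < n) u k j = \sum_(j < n) w j)%N ->
  \sum_(j < n) (w j)%:R * (c k j + q j) <=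
  \sum_(j < n) (u k j)%:R * (c k j + q j).
Proof.
move=> pr lt_k le1 wJ sumE; pose v (j : 'I_n) := c k j + q j.
(* The threshold [t] is the least cost plus price among the items held by [u] but not by [w]: those
   gained by [w] lie below it, those lost above. Without such an item [u] is contained in [w], and
   equal sizes make them equal. *)
have dichotomy : (exists t : R, forall j : 'I_n,
    ((w j)%:R - (u k j)%:R) * (v j - t) <= 0) \/
    (forall j : 'I_n, u k j = w j).
  have [/existsP[i0 i0P]|/existsPn none] :=
      boolP [exists i : 'I_n, (0 < u k i)%N && (w i == 0%N)].
    left; pose i := [arg min_(i < i0 | (0 < u k i)%N && (w i == 0%N)) v i]%O.
    exists (v i); rewrite /i; case: Order.TotalTheory.arg_minP => // {}i /andP[ui wi] imin j.
    have [leu lew] := le1 j (ltn_ord j).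
    case: (posnP (u k j)) => uj; case: (posnP (w j)) => wj.
    - by rewrite uj wj subrr mul0r.
    - have -> : w j = 1%N by lia.
      rewrite uj subr0 mul1r subr_le0; apply: pr => //; first exact: ltnW.
      exact: wJ.
    - have -> : u k j = 1%N by lia.
      rewrite wj sub0r mulN1r oppr_le0 subr_ge0; apply: imin.
      by rewrite uj wj.
    - have -> : u k j = 1%N by lia.
      have -> : w j = 1%N by lia.
      by rewrite subrr mul0r.
  right; have le_uw (j : 'I_n) : (u k j <= w j)%N.
    have [leu lew] := le1 j (ltn_ord j); have := none j.
    by case: (posnP (w j)) => [->|]; lia.
  move=> j; apply/eqP; rewrite eqn_leq le_uw /=.
  have := sumE; rewrite (bigD1 j) //= [in RHS](bigD1 j) //= => {}sumE.
  have : (\sum_(i < n | i != j) u k i <= \sum_(i < n | i != j) w i)%N.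
    by apply: leq_sum.
  move: sumE; move: (\sum_(i < n | i != j) u k i)%N => a.
  by move: (\sum_(i < n | i != j) w i)%N => b; lia.
case: dichotomy => [[t tP]|uw]; last first.
  by rewrite le_eqVlt; apply/orP; left; apply/eqP/eq_bigr => j _; rewrite uw.
rewrite -subr_le0 -sumrB.
have -> : \sum_(j < n) ((w j)%:R * (c k j + q j) - (u k j)%:R * (c k j + q j)) =
    \sum_(j < n) (((w j)%:R - (u k j)%:R) * (v j - t)).
  (* Equal cardinalities let the threshold drop out of the sum. *)
  have tE : \sum_(j < n) ((w j)%:R - (u k j)%:R) * t = 0.
    by rewrite -mulr_suml sumrB -!natr_sum sumE subrr mul0r.
  rewrite -[LHS]subr0 -[X in _ - X]tE -sumrB; apply: eq_bigr => j _.
  by rewrite /v; ring.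
by apply: sumr_le0 => j _.
Qed.

(** The line of slope [q j] through the point at [N j] lies above the concave [h j]: beyond [N j]
    every increment is at most [q j], before it at least [q j]. Induction on the distance, in each
    direction. *)
Lemma balanced_tangent (h : nat -> nat -> R) N q j x :
  (forall j x, (j < n)%N -> (x.+1 < B j)%N -> mu j x.+1 <= mu j x) ->
  (forall x, mu j x = h j x.+1 - h j x) ->
  balanced N q -> (j < n)%N -> (x <= B j)%N ->
  h j x - h j (N j) <= q j * (x%:R - (N j)%:R).
Proof.
move=> conc muE ba lt_j; have [NB up down] := ba j lt_j.
have [le_x|/ltnW le_x] := leqP (N j) x.
  rewrite -(subnKC le_x); elim: (x - N j)%N => [|d IH] leB.
    by rewrite addn0 !subrr mulr0.
  have mud e : (N j + e < B j)%N -> mu j (N j + e) <= q j.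
    elim: e => [|e IHe] lt_B; first by rewrite addn0 up // -[N j]addn0.
    rewrite addnS; apply: le_trans (IHe _); last by lia.
    by apply: conc => //; rewrite -addnS.
  have := mud d; rewrite -addnS leB => /(_ isT); have := IH (ltnW _).
  rewrite -addnS leB => /(_ isT); rewrite addnS -natr1 muE.
  by move: (h _ _) (h _ _) (h _ _) => a b e; lra.
have mud e : (e < N j)%N -> q j <= mu j (N j - e.+1).
  elim: e => [|e IHe] lt_N; first by rewrite subn1 down.
  apply: le_trans (IHe (ltnW lt_N)) _.
  have -> : (N j - e.+1 = (N j - e.+2).+1)%N by lia.
  by apply: conc => //; lia.
move=> _; rewrite -(subKn le_x); elim: (N j - x)%N (leq_subr x (N j)) => [|d IH].
  by rewrite subn0 !subrr mulr0.
move=> lt_d; have := mud d lt_d; have := IH (ltnW lt_d); rewrite muE.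
have -> : (N j - d = (N j - d.+1).+1)%N by lia.
rewrite -natr1; move: (h _ _) (h _ _) (h _ _) => a b e; lra.
Qed.
(** Tangents bound the gain of [w] by the priced difference of the loads. That difference splits
    into rows, and with zero costs each row of [u] already has largest total price. *)
Lemma priced_optimal (h : nat -> nat -> R) u N q w :
  (forall k j, c k j = 0) ->
  (forall j x, (j < n)%N -> (x.+1 < B j)%N -> mu j x.+1 <= mu j x) ->
  (forall j x, mu j x = h j x.+1 - h j x) ->
  allowed u -> priced u q -> balanced N q ->
  (forall j, (j < n)%N -> N j = (\sum_(k < K) u k j)%N) ->
  (forall k, (k < K)%N -> (\sum_(j < n) u k j)%N = r k) ->
  feasible_rows w ->
  \sum_(j < n) h j (\sum_(k < K) w k j)%N <= \sum_(j < n) h j (N j).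
Proof.
move=> c0 conc muE al pr ba NE urow [wal wrow wcol].
rewrite -subr_le0 -sumrB.
apply: le_trans (_ : \sum_(j < n) \sum_(k < K)
    ((w k j)%:R * q j - (u k j)%:R * q j) <= _).
  apply: ler_sum => j _; have lt_j := ltn_ord j.
  apply: le_trans (balanced_tangent conc (muE j) ba lt_j (wcol j lt_j)) _.
  rewrite NE // !natr_sum mulrBr !mulr_sumr -sumrB le_eqVlt; apply/orP; left.
  by apply/eqP/eq_bigr => k _; rewrite ![q j * _]mulrC.
rewrite exchange_big; apply: sumr_le0 => k _ /=; have lt_k := ltn_ord k.
rewrite sumrB subr_le0.
have costE (v : nat -> nat) :
    \sum_(j < n) (v j)%:R * q j = \sum_(j < n) (v j)%:R * (c k j + q j).
  by apply: eq_bigr => j _; rewrite c0 add0r.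
rewrite (costE (w k)) (costE (u k)); apply: priced_le => //.
- by move=> j lt_j; have [[u1 _] [w1 _]] := (al k j lt_k (ltnW lt_j), wal k j lt_k lt_j).
- by move=> j lt_j; have [] := wal k j lt_k lt_j.
- by rewrite urow ?wrow.
Qed.
End Assignment.

(** * The program and its specification *)

Definition num_items : iexp := var 0.
Definition num_rows : iexp := IGet 0 (ILit 1) (ILit 0).
Definition inc (e : iexp) : iexp := IAdd e (ILit 1).
Definition cell (a : nat) (e : iexp) : iexp := IGet a e (ILit 0).
Definition positive (e : iexp) : bexp := BILe (ILit 1) e.
Definition zero (e : iexp) : bexp := BILe e (ILit 0).

(* Integer arrays: 4 u, 5 B, 6 N, 7 deficits, 8 search stamps, 9 and 10 parent
   item and row; integer variables: 11 to 15 loop counters, 16 whether a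
   candidate has been found, 17 whether it is terminal, 18 to 20 the candidate
   (item, row, new item), 21 weight of the revenues, 22 last stamp.
   Real arrays: 1 q, 2 c, 3 slack of the candidate. *)

Definition margin (j x : iexp) : rexp :=
  RMul (RNat (var 21)) (RSub (REval j (RNat (inc x))) (REval j (RNat x))).

Definition price (j : iexp) : rexp := RGet 1 j (ILit 0).

(** The negated conjunction expresses a disjunction: nothing recorded yet, or a slack no larger than
    the recorded one. *)
Definition consider (g : bexp) (slack : rexp) (terminal : nat) : program :=
  If (BAnd g (BNot (BAnd (positive (var 16))
                         (BNot (BRLe slack (RGet 3 (ILit 0) (ILit 0)))))))
     (Seq (RSet 3 (ILit 0) (ILit 0) slack)
     (Seq (setvar 16 (ILit 1))
     (Seq (setvar 17 (ILit terminal))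
     (Seq (setvar 18 (var 15))
     (Seq (setvar 19 (var 14)) (setvar 20 (var 13)))))))
     Skip.

Definition scan_rooms : program :=
  for_loop 13 num_items
    (consider (BAnd (positive (cell 8 (var 13)))
                    (ILt (cell 6 (var 13)) (cell 5 (var 13))))
       (RSub (price (var 13)) (margin (var 13) (cell 6 (var 13)))) 1).

Definition scan_exchanges : program :=
  for_loop 14 num_rows (for_loop 15 (inc num_items) (for_loop 13 num_items
    (consider
       (BAnd (BAnd (positive (cell 8 (var 15)))
                   (positive (IGet 4 (var 14) (var 15))))
             (BAnd (zero (cell 8 (var 13)))
                   (BAnd (zero (IGet 4 (var 14) (var 13)))
                         (zero (IGet 3 (var 14) (var 13))))))
       (RSub (RAdd (RGet 2 (var 14) (var 15)) (price (var 15)))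
             (RAdd (RGet 2 (var 14) (var 13)) (price (var 13)))) 0))).

Definition lower_prices : program :=
  for_loop 15 (inc num_items)
    (If (positive (cell 8 (var 15)))
        (RSet 1 (var 15) (ILit 0)
           (RSub (price (var 15)) (RGet 3 (ILit 0) (ILit 0))))
        Skip).

Definition grow : program :=
  Seq (setvar 16 (ILit 0))
  (Seq scan_rooms (Seq scan_exchanges (Seq lower_prices
  (If (positive (var 17)) Skip
     (Seq (setvar 22 (inc (var 22)))
     (Seq (ISet 8 (var 20) (ILit 0) (var 22))
     (Seq (ISet 9 (var 20) (ILit 0) (var 18))
          (ISet 10 (var 20) (ILit 0) (var 19))))))))).

Definition entry_price (j : iexp) : rexp :=
  RSub (RAdd (RGet 2 (var 11) j) (price j)) (RGet 2 (var 11) num_items).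

(** The dummy enters row [var 11] as the root, at a price so high that giving it up for any item
    does not gain. The running maximum may start at 0, as only a large enough price is wanted. *)
Definition reset_search : program :=
  Seq (ISet 4 (var 11) num_items (ILit 1))
  (Seq (RSet 1 num_items (ILit 0) (RNat (ILit 0)))
  (Seq (for_loop 13 num_items
          (If (BRLe (price num_items) (entry_price (var 13)))
              (RSet 1 num_items (ILit 0) (entry_price (var 13))) Skip))
  (Seq (for_loop 13 num_items (ISet 8 (var 13) (ILit 0) (ILit 0)))
  (Seq (ISet 8 num_items (ILit 0) (ILit 1))
  (Seq (setvar 22 (ILit 1)) (setvar 17 (ILit 0))))))).

Definition search : program := While (zero (var 17)) grow.

(** Only the item with room changes its load: every other item on the way back to the dummy gains
    one unit and loses one. *)
Definition walk : program :=
  Seq (ISet 6 (var 20) (ILit 0) (inc (cell 6 (var 20))))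
      (While (ILt (var 20) num_items)
        (Seq (ISet 4 (cell 10 (var 20)) (cell 9 (var 20)) (ILit 0))
        (Seq (ISet 4 (cell 10 (var 20)) (var 20) (ILit 1))
             (setvar 20 (cell 9 (var 20)))))).

Definition augment : program := Seq reset_search (Seq search walk).

(* The rows that must take all their allowed items are filled at once: they do
   not contribute to [Rbar], hence cannot be charged for augmentations. *)
Definition fill_row : program :=
  Seq (setvar 22 (ILit 0))
  (Seq (for_loop 13 num_items
          (setvar 22 (IAdd (var 22) (ISub (ILit 1) (IGet 3 (var 14) (var 13))))))
  (Seq (setvar 16 (ISub (ILit 1) (ISub (var 22) (cell 1 (var 14)))))
  (Seq (ISet 7 (var 14) (ILit 0)
          (IMul (ISub (ILit 1) (var 16)) (cell 1 (var 14))))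
  (Seq (ISet 4 (var 14) num_items (ILit 0))
       (for_loop 13 num_items
          (Seq (ISet 4 (var 14) (var 13)
                  (IMul (var 16) (ISub (ILit 1) (IGet 3 (var 14) (var 13)))))
               (ISet 6 (var 13) (ILit 0)
                  (IAdd (cell 6 (var 13)) (IGet 4 (var 14) (var 13)))))))))).

Definition fill : program :=
  Seq (for_loop 13 num_items (ISet 6 (var 13) (ILit 0) (ILit 0)))
      (for_loop 14 num_rows fill_row).

(** The upper end of the interval allowed by [balanced]; at load 0 truncated subtraction yields the
    marginal revenue at 0. *)
Definition init_prices : program :=
  for_loop 13 num_items
    (RSet 1 (var 13) (ILit 0)
       (margin (var 13) (ISub (cell 6 (var 13)) (ILit 1)))).

Definition assign : program :=
  Seq fill (Seq init_prices
    (for_loop 11 num_rows (for_loop 12 (cell 7 (var 11)) augment))).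

Definition copy_column (a b : nat) : program :=
  for_loop 13 num_items (ISet b (var 13) (ILit 0) (cell a (var 13))).

Definition copy_costs : program :=
  for_loop 14 num_rows (for_loop 13 num_items
    (RSet 2 (var 14) (var 13) (RGet 0 (var 14) (var 13)))).

(** The cost array is initially 0, which supplies the costs of the first run. *)
Definition bilevel_solver : program :=
  Seq (copy_column 2 5) (Seq (setvar 21 (ILit 1)) (Seq assign
  (Seq (copy_column 6 5) (Seq (setvar 21 (ILit 0)) (Seq copy_costs assign))))).

(** * Correctness and running time of the program *)

Section Specification.
Variables (R : realType) (orc : nat -> R -> R).
Implicit Types m : memory R.

Notation nE m := (imem m 0%N 0%N 0%N).
Notation KE m := (imem m 0%N 1%N 0%N).
Notation rE m := (fun k => imem m 1%N k 0%N).
Notation JE m := (imem m 3%N).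
Notation uE m := (imem m 4%N).
Notation BE m := (fun j => imem m 5%N j 0%N).
Notation NE m := (fun j => imem m 6%N j 0%N).
Notation SE m := (fun j => imem m 8%N j 0%N).
Notation piE m := (fun j => imem m 9%N j 0%N).
Notation pkE m := (fun j => imem m 10%N j 0%N).
Notation qE m := (fun j => rmem m 1%N j 0%N).
Notation cE m := (rmem m 2%N).
Notation ivar m a := (imem m a 0%N 0%N).
Definition muE m (j x : nat) : R :=
  (ivar m 21%N)%:R * (orc j (x + 1)%N%:R - orc j x%:R).

Section Scan.
Variables (valid : cand -> Prop) (slack : cand -> R).

Definition at_cand m (k i j t : nat) (x : cand) : Prop :=
  match x with
  | inl j' => t = 1%N /\ j = j'
  | inr (k', i', j') => [/\ t = 0%N, k = k', i = i' & j = j']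
  end.

Definition recorded m (x : cand) : Prop :=
  at_cand m (ivar m 19) (ivar m 18) (ivar m 20) (ivar m 17) x.

Definition scanned (seen : cand -> Prop) m : Prop :=
  if ivar m 16 == 0%N then forall x, seen x -> ~ valid x
  else exists x, [/\ valid x, recorded m x, rmem m 3%N 0%N 0%N = slack x
    & forall z, seen z -> valid z -> slack x <= slack z].

(** Only valid candidates need to have been seen, so index ranges are taken from validity. *)
Lemma scanned_sub (seen seen' : cand -> Prop) m :
  (forall x, valid x -> seen' x -> seen x) -> scanned seen m -> scanned seen' m.
Proof.
move=> sub; rewrite /scanned; case: ifP => _.
  by move=> H x sx vx; apply: (H x) => //; apply: sub.
by move=> [x [vx rx sx H]]; exists x; split=> // z sz vz; apply: H => //; apply: sub.
Qed.

Lemma run_consider g e (t : nat) x seen m :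
  (beval orc m g <-> valid x) -> (valid x -> reval orc m e = slack x) ->
  at_cand m (ivar m 14) (ivar m 15) (ivar m 13) t x ->
  scanned seen m ->
  run orc (consider g e t) m (60 + bcost g + 2 * rcost e)
    (scanned (fun y => seen y \/ y = x)).
Proof.
move=> gE eE xE sc; eapply run_le.
  apply: run_if => /= [/andP[/gE vx better]|better].
    apply: run_seq; apply: run_rset.
    do 4![apply: run_seq; apply: run_iset]; apply: run_iset.
    rewrite /scanned /=; exists x; rewrite /= eE //; split=> // z.
    case=> [sz vz|-> //].
    move: better sc; rewrite /scanned eE //; case: posnP => /= [_ _ /(_ z sz)//|fpos].
    rewrite negbK => le_x [y [_ _ bE H]].
    by apply: le_trans le_x _; rewrite bE; apply: H.
  apply: run_skip; move: sc; rewrite /scanned.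
  move: better; case: posnP => /= [f0|fpos].
    rewrite andbT => /negP better H y [sy|-> vx]; first exact: H.
    by apply: better; apply/gE.
  move=> better [y [vy ry sy H]]; exists y; split=> // z [sz|->] vz; first exact: H.
  move: better; rewrite (_ : beval orc m g) /=; last exact/gE.
  by rewrite negbK eE // -ltNge sy => /ltW.
rewrite /=; lia.
Qed.
End Scan.

Definition candE m :=
  is_cand (nE m) (KE m) (JE m) (BE m) (uE m) (NE m) (SE m).
Definition slackE m := cand_slack (cE m) (muE m) (qE m) (NE m).

Lemma run_scan_rooms m : ivar m 16 = 0%N ->
  run orc scan_rooms m (200 * (nE m).+1)
    (scanned (candE m) (slackE m) (fun x => if x is inl _ then True else False)).
Proof.
move=> f0.
pose seen y (x : cand) : Prop := if x is inl j then (j < y)%N else False.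
eapply run_le; first apply: (run_impl (Q := scanned (candE m) (slackE m) (seen (nE m)))).
- apply: (run_for_const (I := fun y => scanned (candE m) (slackE m) (seen y))) => //.
  + by move=> m' F /=; rewrite (F.1 0%N isT).
  + by rewrite /scanned /= /upd /= f0 eqxx; case=> [j|].
  move=> y m' lt_y F yE sc.
  eapply run_impl; first apply: (run_consider (x := inl y) _ _ _ sc) => /=.
  + rewrite yE (F.1 8%N isT) (F.1 6%N isT) (F.1 5%N isT) addn1.
    by split=> [/andP[Sy ltB]|[_ Sy ltB]]; [split|rewrite Sy].
  + rewrite /muE yE (F.1 6%N isT) (F.1 21%N isT) (F.2 1%N isT).
    by [].
  + by rewrite yE.
  move=> m'' _; apply: (scanned_sub (seen' := seen y.+1)) => -[j _|//] /=.
  by rewrite ltnS leq_eqVlt => /orP[/eqP->|]; [right|left].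
- move=> m' _; apply: scanned_sub => -[j [lt_j _ _] _|//]; exact: lt_j.
- by rewrite /=; lia.
Qed.

Lemma run_scan_exchanges m :
  scanned (candE m) (slackE m) (fun x => if x is inl _ then True else False) m ->
  run orc scan_exchanges m (1000 * ((nE m).+1 ^ 2 * (KE m).+1))
    (scanned (candE m) (slackE m) (fun=> True)).
Proof.
(* Three nested loops visit the exchanges in lexicographic order; all rooms were scanned before. *)
pose seen k i j (x : cand) : Prop := if x is inr (k', i', j') then
  [|| (k' < k)%N, (k' == k) && (i' < i)%N | [&& k' == k, i' == i & (j' < j)%N]]
  else true.
move=> sc0.
eapply run_le; first apply: (run_impl (Q := scanned (candE m) (slackE m) (seen (KE m) 0 0)%N)).
- apply: (run_for_const (I := fun k => scanned (candE m) (slackE m) (seen k 0 0)%N)) => //.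
  + by move=> m' F /=; rewrite (F.1 0%N isT).
  + by apply: scanned_sub sc0 => -[//|[[k i] j]] _ /=; rewrite !andbF.
  move=> k m1 lt_k F1 kE sc1.
  eapply run_impl.
    apply: (run_for_const (x := (nE m).+1)
      (I := fun i => scanned (candE m) (slackE m) (seen k i 0)%N)) => //.
    + by move=> m' F /=; rewrite (F.1 0%N isT) (F1.1 0%N isT) addn1.
    move=> i m2 lt_i F2 iE sc2.
    eapply run_impl.
      apply: (run_for_const (x := nE m)
        (I := fun j => scanned (candE m) (slackE m) (seen k i j)%N)) => //.
      + by move=> m' F /=; rewrite (F.1 0%N isT) (F2.1 0%N isT) (F1.1 0%N isT).
      move=> j m3 lt_j F3 jE sc3.
      have E a : a \in [:: 3; 4; 8; 21]%N -> imem m3 a = imem m a.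
        by move=> aP; rewrite F3.1 ?F2.1 ?F1.1 //; move: a aP; apply/allP.
      have Er a : a \in [:: 1; 2]%N -> rmem m3 a = rmem m a.
        by move=> aP; rewrite F3.2 ?F2.2 ?F1.2 //; move: a aP; apply/allP.
      have k3 : ivar m3 14 = k by rewrite (F3.1 14%N isT) (F2.1 14%N isT).
      have i3 : ivar m3 15 = i by rewrite (F3.1 15%N isT).
      eapply run_impl; first apply: (run_consider (x := inr (k, i, j)) _ _ _ sc3) => /=.
      + rewrite k3 i3 jE !E // !leqn0; split.
          by move=> /andP[/andP[Si ui] /and3P[/eqP Sj /eqP uj /eqP Jj]].
        by move=> [_ [-> -> -> -> ->]].
      + by rewrite k3 i3 jE !Er.
      + by rewrite k3 i3 jE.
      move=> m4 _; apply: (scanned_sub (seen' := seen k i j.+1)).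
      case=> [?|[[k' i'] j']] _ /=; first by left.
      case: (ltnP k' k) => [|le_k] /=; first by left.
      case: eqVneq => [->|] //=; case: (ltnP i' i) => [|le_i] /=; first by left.
      case: eqVneq => [->|] //=; rewrite ltnS leq_eqVlt => /orP[/eqP->|->]; last by left.
      by right.
    move=> m3 _; apply: (scanned_sub (seen' := seen k i.+1 0%N)).
    case=> [//|[[k' i'] j']] [[_ _ lt_j] _] /=.
    case: (ltnP k' k) => [//|le_k] /=; case: eqVneq => [_|] //=.
    by rewrite !andbF orbF ltnS leq_eqVlt => /orP[/eqP->|->//]; rewrite eqxx lt_j orbT.
  move=> m3 _; apply: (scanned_sub (seen' := seen k.+1 0%N 0%N)).
  case=> [//|[[k' i'] j']] [[_ le_i _] _] /=.
  rewrite !andbF !orbF ltnS leq_eqVlt => /orP[/eqP->|->//].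
  by rewrite eqxx ltnS le_i orbT.
- move=> m' _; apply: scanned_sub => -[//|[[k i] j]] [[lt_k _ _] _] _ /=.
  by rewrite lt_k.
- by rewrite /=; nia.
Qed.
Lemma run_lower_prices m :
  run orc lower_prices m (100 * (nE m).+1)
    (fun m' => qE m' = lower (nE m) (SE m) (qE m) (rmem m 3%N 0%N 0%N)).
Proof.
pose I y m' := forall j, qE m' j =
  if (0 < SE m j)%N && (j < y)%N then qE m j - rmem m 3%N 0%N 0%N else qE m j.
eapply run_le; first apply: (run_impl (Q := I (nE m).+1)).
- apply: (run_for_const (I := I)) => //.
  + by move=> m' F /=; rewrite (F.1 0%N isT) addn1.
  + by move=> j; rewrite andbF.
  move=> y m' lt_y F yE Iy; apply: run_if => /=.
    rewrite yE (F.1 8%N isT) => Sy; apply: run_rset => j /=.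
    rewrite /upd /= yE andbT (F.2 3%N isT).
    rewrite [(j < y.+1)%N]ltnS [(j <= y)%N]leq_eqVlt.
    case: (eqVneq j y) => [->|_] /=; last exact: Iy.
    by rewrite Sy Iy ltnn andbF.
  rewrite yE (F.1 8%N isT) -eqn0Ngt => /eqP Sy; apply: run_skip => j /=.
  rewrite [(j < y.+1)%N]ltnS [(j <= y)%N]leq_eqVlt Iy.
  by case: (eqVneq j y) => [->|_] //=; rewrite Sy.
- by move=> m' _ H; apply/funext => j; rewrite H /lower ltnS.
- by rewrite /=; lia.
Qed.

(** * Growing the alternating tree *)

Definition search_inv m : Prop :=
  [/\ priced (nE m) (KE m) (JE m) (cE m) (uE m) (qE m),
      balanced (nE m) (BE m) (muE m) (NE m) (qE m),
      tree (nE m) (KE m) (JE m) (cE m) (uE m) (qE m) (SE m) (piE m) (pkE m),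
      forall j, (j <= nE m)%N -> (SE m j <= ivar m 22)%N
    & (\sum_(j < (nE m).+1) (0 < SE m j) = ivar m 22)%N].

Definition room_found m : Prop :=
  let j := ivar m 20 in
  [/\ (j < nE m)%N, (0 < SE m j)%N, (NE m j < BE m j)%N
    & qE m j = muE m j (NE m j)].

Lemma run_grow m : search_inv m -> ~ (forall x, ~ candE m x) ->
  run orc grow m (3000 * ((nE m).+1 ^ 2 * (KE m).+1))
    (fun m' => search_inv m' /\
       if ivar m' 17 == 0%N then ivar m' 22 = (ivar m 22).+1 else room_found m').
Proof.
move=> [pr ba tr Sle cnt] cands.
pose m1 := Memory (upd (imem m) 16 0%N 0%N 0%N) (rmem m).
eapply run_le.
  apply: run_seq; apply: run_iset.
  apply: run_seq; eapply run_impl; first exact: (run_scan_rooms (m := m1)).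
  move=> m2 F2 sc2; apply: run_seq.
  have E2 a : a \in [:: 0; 3; 4; 5; 6; 8; 9; 10; 21; 22]%N -> imem m2 a = imem m a.
    move=> aP; rewrite F2.1 /= ?upd_neq //; move: a aP; exact/allP.
  have Er2 a : a \in [:: 1; 2]%N -> rmem m2 a = rmem m a.
    by move=> aP; rewrite F2.2 //; move: a aP; apply/allP.
  have cE2 : candE m2 = candE m by rewrite /candE !E2.
  have sE2 : slackE m2 = slackE m by rewrite /slackE /muE !E2 // !Er2.
  have ex2 := run_scan_exchanges (m := m2).
  rewrite cE2 sE2 !E2 // in ex2.
  eapply run_impl; first exact: ex2.
  move=> m3 F3 sc3; apply: run_seq.
  have E3 a : a \in [:: 0; 3; 4; 5; 6; 8; 9; 10; 21; 22]%N -> imem m3 a = imem m a.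
    by move=> aP; rewrite F3.1 ?E2 //; move: a aP; exact/allP.
  have Er3 a : a \in [:: 1; 2]%N -> rmem m3 a = rmem m a.
    by move=> aP; rewrite F3.2 ?Er2 //; move: a aP; exact/allP.
  have lo3 := run_lower_prices m3; rewrite !E3 // (Er3 1%N) // in lo3.
  eapply run_impl; first exact: lo3.
  move=> m4 F4 q4.
  have E4 a : a \in [:: 0; 3; 4; 5; 6; 8; 9; 10; 21; 22]%N -> imem m4 a = imem m a.
    by move=> aP; rewrite F4.1 ?E3 //; move: a aP; exact/allP.
  have c4 : cE m4 = cE m by rewrite F4.2 ?Er3.
  have {sc3} : scanned (candE m) (slackE m) (fun=> True) m4.
    move: sc3; rewrite /scanned /recorded.
    by rewrite !(F4.1 16%N isT, F4.1 17%N isT, F4.1 18%N isT, F4.1 19%N isT,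
      F4.1 20%N isT, F4.2 3%N isT).
  rewrite /scanned; case: eqP => [_ none|_ [x [xc xr xs xmin]]].
    by case: cands => x; apply: none.
  have dmin z : candE m z -> rmem m3 3%N 0%N 0%N <= slackE m z.
    by rewrite -(F4.2 3%N isT) xs; apply: xmin.
  have d_ge0 : 0 <= rmem m3 3%N 0%N 0%N.
    by rewrite -(F4.2 3%N isT) xs; apply: cand_slack_ge0 xc.
  have pr4 : priced (nE m) (KE m) (JE m) (cE m) (uE m) (qE m4).
    by rewrite q4; exact: (priced_lower d_ge0 dmin pr).
  have ba4 : balanced (nE m) (BE m) (muE m) (NE m) (qE m4).
    by rewrite q4; exact: (balanced_lower d_ge0 dmin ba).
  have tr4 : tree (nE m) (KE m) (JE m) (cE m) (uE m) (qE m4) (SE m) (piE m) (pkE m).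
    by rewrite q4; apply: tree_lower tr.
  have mu4 : muE m4 = muE m by rewrite /muE !E4.
  apply: run_if => /=.
    move=> t1; apply: run_skip; split.
      by split; rewrite ?mu4 ?E4 ?c4.
    rewrite gtn_eqF // /room_found mu4 !(E4 0%N isT, E4 5%N isT, E4 6%N isT, E4 8%N isT).
    case: x xc xr xs {xmin} => [j [lt_j Sj NB]|[[k i] j] _] []; last first.
      by move=> t0; rewrite t0 in t1.
    move=> _ -> /=; rewrite (F4.2 3%N isT) => xs; split=> //.
    (* The price of the reached item has fallen by exactly its slack, down to the marginal
       revenue. *)
    have /= -> := congr1 (@^~ j) q4.
    by rewrite /lower Sj (ltnW lt_j) /= xs /slackE /=; ring.
  rewrite -eqn0Ngt => /eqP t0.
  case: x xc xr xs {xmin} => [j _ [t1 _]|[[k i] j] xc [_ kE iE jE]].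
    by rewrite t1 in t0.
  rewrite (F4.2 3%N isT) => xs.
  have [[lt_k le_i lt_j] [Si ui Sj uj Jj]] := xc.
  do 3![apply: run_seq; apply: run_iset]; apply: run_iset => /=.
  rewrite /upd /= t0 (E4 22%N isT) addn1 kE iE jE; split=> //.
  (* Only the reached side [i] has fallen, by exactly the slack of the exchange. *)
  have tight : cE m k j + qE m4 j = cE m k i + qE m4 i.
    have /= -> := congr1 (@^~ j) q4; have /= -> := congr1 (@^~ i) q4.
    by rewrite /lower Si Sj le_i /= xs /slackE /=; ring.
  split=> /=.
  - by rewrite c4 !(E4 0%N isT, E4 3%N isT, E4 4%N isT).
  - rewrite -[muE _]/(muE m4) mu4.
    by rewrite !(E4 0%N isT, E4 5%N isT, E4 6%N isT).
  - have /= := tree_add (B := BE m) (N := NE m) tr4 xc tight Sle.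
    rewrite c4 !(E4 0%N isT, E4 3%N isT, E4 4%N isT) (E4 8%N isT) (E4 9%N isT) (E4 10%N isT).
    have ite (v : nat) (g : nat -> nat) :
        (fun x => if x == j then v else g x) =
        (fun x => if (x == j) && (0 == 0)%N then v else g x).
      by apply/funext => x; rewrite andbT.
    by rewrite (ite _ (SE m)) (ite _ (piE m)) (ite _ (pkE m)).
  - rewrite (E4 0%N isT) (E4 8%N isT) => x le_x; case: ifP => // _.
    by apply: leqW; apply: Sle.
  - rewrite (E4 0%N isT) (E4 8%N isT).
    have := sum_update (fun x => (0 < SE m x)%N : nat) 1 (leqW lt_j).
    rewrite Sj addn0 addn1 cnt; apply: etrans.
    by apply: eq_bigr => x _; case: eqP.
have X1 : ((nE m).+1 <= (nE m).+1 ^ 2 * (KE m).+1)%N by nia.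
rewrite -[nE m1]/(nE m) /=; move: X1; move: (_ ^ 2 * _)%N => X; lia.
Qed.
Lemma run_search m :
  search_inv m -> ivar m 17 = 0%N -> ivar m 22 = 1%N ->
  (forall S, (0 < S (nE m))%N ->
     ~ forall x, ~ is_cand (nE m) (KE m) (JE m) (BE m) (uE m) (NE m) S x) ->
  run orc search m (4000 * ((nE m).+1 ^ 3 * (KE m).+1))
    (fun m' => search_inv m' /\ room_found m').
Proof.
move=> inv0 t0 s0 cands.
(* Until a room is found the ghost counter is the last stamp, which counts the reached items among
   [n + 1]. It starts at 1 for the root, so the bound [n + 2] allows [n + 1] scans. *)
pose I y m' := search_inv m' /\
  if ivar m' 17 == 0%N then ivar m' 22 = y else room_found m'.
eapply run_le; first eapply run_impl.
- apply: (run_while (I := I) (M := (nE m).+2)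
    (T := (3000 * ((nE m).+1 ^ 2 * (KE m).+1))%N) (x := 1%N)); last first.
    by split; rewrite ?t0.
  move=> y m' le_y F [inv']; rewrite /= leqn0 => inv_y t0'.
  move: inv_y; rewrite t0' => sE; split.
    have [_ _ _ _ cnt] := inv'; rewrite -sE -cnt (F.1 0%N isT) ltnS.
    apply: leq_trans (_ : (\sum_(j < (nE m).+1) 1 <= _)%N).
      by apply: leq_sum => j _; case: (0 < _)%N.
    by rewrite sum1_card card_ord.
  have cand' : ~ (forall x, ~ candE m' x).
    have [_ _ [Sn _] _ _] := inv'; rewrite (F.1 0%N isT) in Sn.
    move: (cands (SE m') Sn); rewrite /candE.
    by rewrite !(F.1 0%N isT, F.1 3%N isT, F.1 4%N isT, F.1 5%N isT, F.1 6%N isT).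
  have := run_grow inv' cand'; rewrite (F.1 0%N isT) => gr.
  eapply run_impl; first exact: gr.
  move=> m'' _ [inv'' H]; split=> //; move: H.
  by case: ifP => // _ ->; rewrite sE.
- move=> m' _ [[y [inv' H]] tm]; split=> //; move: H tm.
  by rewrite /= leqn0; case: ifP.
- have -> : ((nE m).+1 ^ 3 * (KE m).+1 = (nE m).+1 * ((nE m).+1 ^ 2 * (KE m).+1))%N.
    by rewrite mulnA -expnS.
  have : (0 < (nE m).+1 ^ 2 * (KE m).+1)%N by rewrite muln_gt0 expn_gt0.
  by move: ((nE m).+1 ^ 2 * (KE m).+1)%N => X /=; nia.
Qed.

(** * Augmenting along the path to the root *)

Lemma run_walk m k0 :
  search_inv m -> room_found m ->
  (forall j x, (j < nE m)%N -> (x.+1 < BE m j)%N -> muE m j x.+1 <= muE m j x) ->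
  allowed (nE m) (KE m) (JE m) (uE m) ->
  (forall k, (k < KE m)%N -> uE m k (nE m) = (k == k0)) ->
  (forall j, (j < nE m)%N -> NE m j = (\sum_(k < KE m) uE m k j)%N) ->
  run orc walk m (100 * (nE m).+1)
    (fun m' => [/\ allowed (nE m) (KE m) (JE m) (uE m'),
        priced (nE m) (KE m) (JE m) (cE m) (uE m') (qE m),
        balanced (nE m) (BE m) (muE m) (NE m') (qE m),
        forall j, (j < nE m)%N -> NE m' j = (\sum_(k < KE m) uE m' k j)%N
      & forall k, (k < KE m)%N -> uE m' k (nE m) = 0%N /\
         (\sum_(j < (nE m).+1) uE m' k j = \sum_(j < (nE m).+1) uE m k j)%N]).
Proof.
move=> [pr ba [Sn tr] Sle cnt] [lt_b Sb NB qb] conc al dum NE_.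
set n := nE m; set K := KE m; set b := ivar m 20.
(* [N] already counts the unit whose room was found; going back to the root, it
   is the current item that still lacks it. *)
pose N1 j := if j == b then (NE m j).+1 else NE m j.
pose m1 := Memory (upd (imem m) 6 b 0%N (NE m b).+1) (rmem m).
(* Stamps strictly decrease on the path, so [y] plus the current stamp stays at most [n + 1]. Only
   links with stamps up to the current one are still needed, and these survive the exchanges. *)
pose I y m' := let cur := ivar m' 20 in let u := uE m' in
  [/\ (cur <= n)%N /\ allowed n K (JE m) u, priced n K (JE m) (cE m) u (qE m),
    forall j, (j < n)%N -> (\sum_(k < K) u k j + (j == cur) = N1 j)%N,
    forall k, (k < K)%N -> u k n = ((k == k0) && (cur != n)) /\
         (\sum_(j < n.+1) u k j = \sum_(j < n.+1) uE m k j)%N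
  & (0 < SE m cur)%N /\ (y + SE m cur <= n.+1)%N /\
    forall j, (j < n)%N -> (0 < SE m j <= SE m cur)%N ->
      link n K (JE m) (cE m) u (qE m) (SE m) (piE m) (pkE m) j].
have N1E : NE m1 = N1.
  apply/funext => j; rewrite /N1 /= /upd /= andbT.
  by case: eqP => [->|].
have s_le : (ivar m 22 <= n.+1)%N.
  rewrite -cnt; apply: leq_trans (_ : (\sum_(j < (nE m).+1) 1 <= _)%N).
    by apply: leq_sum => j _; case: (0 < _)%N.
  by rewrite sum1_card card_ord.
have E1 a : a != 6%N -> imem m1 a = imem m a by move=> ne; exact: upd_neq.
eapply run_le.
- apply: run_seq; apply: run_iset; rewrite -[ieval _ (var 20)]/b.
  rewrite [ieval _ (inc _)]addn1 -/m1.
  apply: (run_impl (Q := fun m' => (exists y, I y m') /\ ~~ (ivar m' 20 < n)%N)).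
    eapply run_impl.
      apply: (run_while (I := I) (M := n.+1) (x := 0%N)); last first.
        split; rewrite ?(E1 4%N) ?(E1 20%N) //=.
        - by split=> //; apply: ltnW.
        - by move=> j lt_j; rewrite /N1 NE_ //; case: (j == b); rewrite ?addn1 ?addn0.
        - by move=> k lt_k; rewrite dum // neq_ltn lt_b andbT.
        - split=> //; split; first exact: leq_trans (Sle _ (ltnW lt_b)) s_le.
          by move=> j lt_j /andP[Sj _]; apply: tr.
      move=> y m2 _ F [[le_c al2] pr2 col2 row2 [Sc [Sy lk2]]].
      set cur := ivar m2 20 in le_c col2 row2 Sc Sy lk2 *.
      rewrite /= (F.1 0%N isT) (E1 0%N) // addn1 -/n -/cur => lt_c.
      have lk := lk2 cur lt_c; rewrite Sc leqnn in lk; have {}lk := lk isT.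
      have [le_p lt_k /andP[Sp lt_p] [up uc Jc] tight] := lk.
      split; first by lia.
      apply: run_seq; apply: run_iset; apply: run_seq; apply: run_iset.
      apply: run_iset; rewrite /I /= /upd /= !(F.1 8%N isT, F.1 9%N isT, F.1 10%N isT).
      rewrite -/cur !(E1 9%N, E1 10%N) //.
      set p := piE m cur in le_p Sp lt_p up tight *.
      set kk := pkE m cur in lt_k up uc Jc tight *.
      rewrite -[fun i' j' => if _ then 1%N else _]/(swap (uE m2) kk p cur).
      split=> /=.
      + by split=> //; apply: (allowed_swap lk).
      + exact: (priced_swap lt_c lk).
      + by move=> j lt_j; rewrite -(col2 j lt_j); apply: (col_swap lk j al2).
      + move=> k lt_kK; have [uk rk] := row2 k lt_kK; split; last first.
          by rewrite -rk; apply: (row_swap lt_c lk k al2).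
        rewrite (gtn_eqF lt_c) andbF uk (ltn_eqF lt_c) andbT.
        (* If the parent is the dummy, the exchange takes place in row [k0], the only row holding
           it, and removes it there. *)
        case: (eqVneq n p) => [pE|]; last by rewrite andbF andbT.
        rewrite andbT andbF; case: (eqVneq k kk) => [//|ne_k].
        have [ukk _] := row2 kk lt_k; move: up; rewrite -pE ukk.
        by case: (eqVneq kk k0) => [<- _|//]; rewrite (negbTE ne_k).
      + split=> //; split; first by lia.
        move=> j lt_j /andP[Sj le_S].
        apply: (link_swap lk lt_j le_S); apply: lk2 => //.
        by rewrite Sj (leq_trans le_S) // ltnW.
    move=> m2 F [Iy /=]; rewrite (F.1 0%N isT) (E1 0%N) // addn1 => /negP nlt.
    by split=> //; apply/negP.
  move=> m2 F2 [[y [[le_c al2] pr2 col2 row2 [Sc [Sy lk2]]]]]; rewrite -leqNgt => ge_c.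
  have cE : ivar m2 20 = n by apply/eqP; rewrite eqn_leq le_c ge_c.
  rewrite cE in col2 row2.
  have N2E : NE m2 = N1 by rewrite (F2.1 6%N isT).
  split=> //.
  + by rewrite N2E; apply: balanced_incr.
  + move=> j lt_j; rewrite -[LHS]/(NE m2 j) N2E -(col2 j lt_j).
    by rewrite (ltn_eqF lt_j) addn0.
  + by move=> k lt_k; have [-> ->] := row2 k lt_k; rewrite eqxx andbF.
- by rewrite /=; lia.
Qed.

(** The state between two augmentations: no row holds the dummy, and row [k] has [d k] items so
    far. *)
Definition matched (d : nat -> nat) m : Prop :=
  [/\ allowed (nE m) (KE m) (JE m) (uE m) /\
       (forall k, (k < KE m)%N -> uE m k (nE m) = 0%N),
      priced (nE m) (KE m) (JE m) (cE m) (uE m) (qE m),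
      balanced (nE m) (BE m) (muE m) (NE m) (qE m),
      forall j, (j < nE m)%N -> NE m j = (\sum_(k < KE m) uE m k j)%N
    & forall k, (k < KE m)%N -> (\sum_(j < nE m) uE m k j = d k)%N].

Lemma run_reset_search d m : matched d m -> (ivar m 11 < KE m)%N ->
  run orc reset_search m (300 * (nE m).+1)
    (fun m' => [/\ search_inv m', ivar m' 17 = 0%N, ivar m' 22 = 1%N &
      uE m' = fun k j =>
        if (k == ivar m 11) && (j == nE m) then 1%N else uE m k j]).
Proof.
move=> [[al dum] pr ba NE_ rows] lt_k0.
set n := nE m; set k0 := ivar m 11.
pose u1 k j := if (k == k0) && (j == n) then 1%N else uE m k j.
pose m1 := Memory (upd (imem m) 4 k0 n 1%N) (upd (rmem m) 1 n 0%N 0%:R).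
have E1 a : a != 4%N -> imem m1 a = imem m a by move=> ne; exact: upd_neq.
have Er1 a : a != 1%N -> rmem m1 a = rmem m a by move=> ne; exact: upd_neq.
pose I y m' := forall j, (j <= n)%N ->
  ((j < n)%N -> qE m' j = qE m j) /\
  ((j < y)%N -> cE m k0 j + qE m j - cE m k0 n <= qE m' n).
eapply run_le.
- apply: run_seq; apply: run_iset; apply: run_seq; apply: run_rset.
  rewrite /= -/k0 -/n -/m1; apply: run_seq.
  eapply run_impl.
    apply: (run_for_const (I := I) (x := n)) => //.
    + by move=> m' F /=; rewrite (F.1 0%N isT).
    + by move=> j le_j; split=> //= lt_j; rewrite /upd /= (ltn_eqF lt_j).
    move=> y m2 lt_y F yE Iy; apply: run_if => /=.
      rewrite yE !(F.1 11%N isT, F.1 0%N isT, F.2 2%N isT) (E1 11%N) // (E1 0%N) //.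
      rewrite (Er1 2%N) // -/n -/k0 => le_q; apply: run_rset => j le_j /=.
      rewrite /upd /= yE !(F.1 11%N isT, F.1 0%N isT, F.2 2%N isT) (E1 11%N) // (E1 0%N) //.
      rewrite (Er1 2%N) // -/n -/k0 eqxx /=; have [qy _] := Iy y (ltnW lt_y).
      have [qj ymax] := Iy j le_j; split.
        by move=> lt_j; rewrite (ltn_eqF lt_j) /= qj.
      rewrite eqxx [(j < y.+1)%N]ltnS leq_eqVlt.
      move=> /orP[/eqP->|lt_jy] /=; first by rewrite (qy lt_y) lexx.
      exact: le_trans (ymax lt_jy) le_q.
    rewrite yE !(F.1 11%N isT, F.1 0%N isT, F.2 2%N isT) (E1 11%N) // (E1 0%N) //.
    rewrite (Er1 2%N) // -/n -/k0 -ltNge => lt_q; apply: run_skip => j le_j /=.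
    have [qj ymax] := Iy j le_j; split=> //.
    rewrite ltnS leq_eqVlt => /orP[/eqP->|//].
    have [qy _] := Iy y (ltnW lt_y).
    by rewrite -(qy lt_y); apply: ltW.
  move=> m2 F2 I2; apply: run_seq.
  have I3 : run orc (for_loop 13 num_items (ISet 8 (var 13) (ILit 0) (ILit 0))) m2
      (100 * n.+1) (fun m' => forall j, (j < n)%N -> SE m' j = 0%N).
    have n2 : nE m2 = n by rewrite (F2.1 0%N isT) (E1 0%N).
    eapply run_le.
      apply: (run_for_const (x := n)
        (I := fun y m' => forall j, (j < y)%N -> SE m' j = 0%N)) => //.
        by move=> m' F /=; rewrite (F.1 0%N isT).
      move=> y m' lt_y F yE Iy; apply: run_iset => j /=.
      rewrite /upd /= yE andbT ltnS leq_eqVlt => /orP[->//|lt_j].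
      by case: ifP => // _; apply: Iy.
    by rewrite /=; lia.
  eapply run_impl; first exact: I3.
  move=> m3 F3 S3; do 2![apply: run_seq; apply: run_iset]; apply: run_iset.
  have E3 a : a \in [:: 0; 3; 4; 5; 6; 21]%N -> imem m3 a = imem m1 a.
    by move=> aP; rewrite F3.1 ?F2.1 //; move: a aP; exact/allP.
  have u3 : uE m3 = u1 by rewrite E3.
  have q3 : qE m3 = qE m2 by rewrite (F3.2 1%N isT).
  have n3 : nE m3 = n by rewrite E3 // E1.
  have mu3 : muE m3 = muE m by rewrite /muE !E3 // !E1.
  rewrite /= /upd /= n3 -/k0; split=> //.
  have c3 : cE m3 = cE m by rewrite (F3.2 2%N isT) (F2.2 2%N isT) Er1.
  have E a : a \in [:: 0; 3; 5; 6; 21]%N -> imem m3 a = imem m a.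
    by move=> aP; rewrite E3 ?E1 //; move: a aP; exact/allP.
  have qj j : (j < n)%N -> qE m3 j = qE m j.
    by move=> lt_j; rewrite (F3.2 1%N isT); have [-> //] := I2 j (ltnW lt_j).
  have qn j : (j < n)%N -> cE m k0 j + qE m j <= cE m k0 n + qE m3 n.
    move=> lt_j; rewrite (F3.2 1%N isT) -lerBlDl.
    by have [_ /(_ lt_j)] := I2 j (ltnW lt_j).
  split=> /=.
  + rewrite c3 n3 u3 !(E 0%N isT, E 3%N isT) => k i j lt_k le_i lt_j.
    rewrite /u1 (ltn_eqF lt_j) andbF; case: andP => [[/eqP-> /eqP->] _ _ _|].
      by rewrite qj // qn.
    move=> ne ui uj Jj.
    case: (eqVneq i n) => [iE|ne_i]; first by move: ui; rewrite iE dum.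
    have lt_i : (i < n)%N by rewrite ltn_neqAle ne_i.
    by rewrite !qj //; apply: pr.
  + rewrite -[muE _]/(muE m3) mu3 !(E 0%N isT, E 5%N isT, E 6%N isT).
    by move=> j lt_j; rewrite qj //; apply: ba.
  + rewrite n3; split=> [|j lt_j]; first by rewrite eqxx.
    by rewrite (ltn_eqF lt_j) S3.
  + rewrite n3 => j le_j; case: (eqVneq j n) => //= ne_j.
    by rewrite S3 // ltn_neqAle ne_j.
  + rewrite n3 big_ord_recr /= big1 => [|j _]; first by rewrite !eqxx.
    by rewrite (ltn_eqF (ltn_ord j)) /= S3.
- by rewrite /=; lia.
Qed.

(** A feasible [w] guarantees through [cand_exists] that the search never stalls, whichever items
    have been reached. *)
Lemma run_augment d w m :
  matched d m -> (ivar m 11 < KE m)%N ->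
  (forall k, (k < KE m)%N -> (d k <= rE m k)%N) ->
  (d (ivar m 11) < rE m (ivar m 11))%N ->
  feasible_rows (nE m) (KE m) (JE m) (rE m) (BE m) w ->
  (forall j x, (j < nE m)%N -> (x.+1 < BE m j)%N -> muE m j x.+1 <= muE m j x) ->
  run orc augment m (4500 * ((nE m).+1 ^ 3 * (KE m).+1))
    (matched (fun k => d k + (k == ivar m 11))%N).
Proof.
move=> mat lt_k0 le_d lt_d wP conc; have [[al dum] pr ba NE_ rows] := mat.
eapply run_le.
- apply: run_seq; eapply run_impl; first exact: (run_reset_search mat).
  move=> m1 F1 [inv1 t1 s1 u1]; apply: run_seq.
  have E1 a : a \in [:: 0; 1; 3; 5; 6; 11; 21]%N -> imem m1 a = imem m a.
    by move=> aP; rewrite F1.1 //; move: a aP; exact/allP.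
  have mu1 : muE m1 = muE m by rewrite /muE !E1.
  have u1n k : (k < KE m)%N -> uE m1 k (nE m) = (k == ivar m 11) :> nat.
    by move=> lt_k; rewrite u1 eqxx andbT; case: eqP => // _; apply: dum.
  have u1j k j : (j < nE m)%N -> uE m1 k j = uE m k j.
    by move=> lt_j; rewrite u1 (ltn_eqF lt_j) andbF.
  have al1 : allowed (nE m) (KE m) (JE m) (uE m1).
    move=> k j lt_k le_j; have [h1 h2] := al k j lt_k le_j.
    rewrite u1; case: andP => [[_ /eqP->]|_]; last by [].
    by rewrite ltnn.
  have N1 j : (j < nE m)%N -> NE m j = (\sum_(k < KE m) uE m1 k j)%N.
    by move=> lt_j; rewrite NE_ //; apply: eq_bigr => k _; rewrite u1j.
  have rows1 k : (k < KE m)%N -> (\sum_(j < nE m) uE m1 k j = d k)%N.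
    by move=> lt_k; rewrite -rows //; apply: eq_bigr => j _; rewrite u1j.
  have se1 := run_search inv1 t1 s1.
  rewrite !(E1 0%N isT, E1 3%N isT, E1 5%N isT, E1 6%N isT) in se1.
  eapply run_impl.
    apply: se1 => S Sn; apply: (cand_exists (r := rE m) (w := w) al1 lt_k0) => //.
    + by rewrite u1n // eqxx.
    + by move=> j lt_j; have [] := ba j lt_j.
    + by move=> k lt_k; rewrite rows1 // le_d.
    + by rewrite rows1.
  move=> m2 F2 [inv2 ro2].
  have E2 a : a \in [:: 0; 1; 3; 4; 5; 6; 11; 21]%N -> imem m2 a = imem m1 a.
    by move=> aP; rewrite F2.1 //; move: a aP; exact/allP.
  have E a : a \in [:: 0; 1; 3; 5; 6; 11; 21]%N -> imem m2 a = imem m a.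
    by move=> aP; rewrite E2 ?E1 //; move: a aP; exact/allP.
  have mu2 : muE m2 = muE m by rewrite /muE !E.
  have wa := run_walk (k0 := ivar m 11) inv2 ro2.
  rewrite mu2 !(E 0%N isT, E 3%N isT, E 5%N isT, E 6%N isT) (E2 4%N isT) in wa.
  eapply run_impl; first exact: (wa conc al1 u1n N1).
  move=> m3 F3 [al3 pr3 ba3 N3 rows3].
  have E3 a : a \in [:: 0; 1; 3; 5; 11; 21]%N -> imem m3 a = imem m a.
    by move=> aP; rewrite F3.1 ?E //; move: a aP; exact/allP.
  have mu3 : muE m3 = muE m by rewrite /muE !E3.
  have q3 : qE m3 = qE m2 by rewrite (F3.2 1%N isT).
  have c3 : cE m3 = cE m2 by rewrite (F3.2 2%N isT).
  rewrite /matched mu3 q3 c3 !(E3 0%N isT, E3 3%N isT, E3 5%N isT).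
  split=> //.
  + by split=> // k lt_k; have [] := rows3 k lt_k.
  (* The walk preserves row sums that include the dummy column; since the dummy leaves row [var 11],
     that row gains a proper item. *)
  + move=> k lt_k; have [un] := rows3 k lt_k.
    by rewrite !big_ord_recr /= un addn0 u1n // => ->; rewrite -(rows1 k lt_k).
- have : ((nE m).+1 <= (nE m).+1 ^ 3 * (KE m).+1)%N.
    by rewrite expnS -mulnA leq_pmulr // muln_gt0 expn_gt0.
  by move: (_ ^ 3 * _)%N => X; rewrite /=; lia.
Qed.

(** * Forced rows and initial prices *)

Definition num_free (n : nat) (J : nat -> nat -> nat) (k : nat) : nat :=
  (\sum_(j < n) (1 - J k j))%N.

Section Fill.
Variable m : memory R.
Let n := nE m.
Let K := KE m.
(** By truncated subtraction this is 1 when row [k] has at most [rE m k] allowed items, and 0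
    otherwise. *)
Definition full k : nat := (1 - (num_free n (JE m) k - rE m k))%N.
Definition deficit k : nat := ((1 - full k) * rE m k)%N.
Definition initial_row k j : nat := (full k * (1 - JE m k j))%N.

Definition filled_rows y m' := forall k, (k < y)%N ->
  [/\ forall j, (j < n)%N -> uE m' k j = initial_row k j, uE m' k n = 0%N
    & imem m' 7%N k 0%N = deficit k].

Lemma run_fill :
  run orc fill m (300 * (n.+1 * K.+1)) (fun m' => filled_rows K m' /\
    forall j, (j < n)%N -> NE m' j = (\sum_(k < K) initial_row k j)%N).
Proof.
pose I y m' := filled_rows y m' /\
  forall j, (j < n)%N -> NE m' j = (\sum_(k < y) initial_row k j)%N.
eapply run_le.
- apply: run_seq; eapply run_impl.
    apply: (run_for_const (x := n)
      (I := fun y m' => forall j, (j < y)%N -> NE m' j = 0%N)) => //.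
      by move=> m' F /=; rewrite (F.1 0%N isT).
    move=> y m' lt_y F yE Iy; apply: run_iset => j /=.
    rewrite /upd /= yE andbT ltnS leq_eqVlt => /orP[->//|lt_j].
    by case: ifP => // _; apply: Iy.
  move=> m1 F1 N1; apply: (run_for_const (x := K) (I := I)) => //.
  + by move=> m' F /=; rewrite (F.1 0%N isT) (F1.1 0%N isT).
  + by split=> [//|j lt_j]; rewrite big_ord0; apply: N1.
  move=> k m2 lt_k F2 kE [rows2 N2].
  have E2 a : a \in [:: 0; 1; 3]%N -> imem m2 a = imem m a.
    by move=> aP; rewrite F2.1 ?F1.1 //; move: a aP; exact/allP.
  have n2 : nE m2 = n by rewrite E2.
  apply: run_seq; apply: run_iset; rewrite /=.
  set m3 := Memory _ _; apply: run_seq; eapply run_impl.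
    apply: (run_for_const (x := n)
      (I := fun y m' => ivar m' 22 = (\sum_(j < y) (1 - JE m k j))%N)) => //.
    + by move=> m' F /=; rewrite (F.1 0%N isT).
    + by rewrite big_ord0.
    move=> y m' lt_y F yE Iy; apply: run_iset.
    rewrite /= /upd /= Iy yE (F.1 14%N isT) (F.1 3%N isT).
    rewrite -[imem m3 14%N]/(imem m2 14%N) -[imem m3 3%N]/(imem m2 3%N).
    by rewrite kE E2 // big_ord_recr.
  move=> m4 F4 free4.
  have E4 a : a \in [:: 0; 1; 3; 4; 6; 7; 14]%N -> imem m4 a = imem m2 a.
    by move=> aP; rewrite F4.1 /= ?upd_neq //; move: a aP; exact/allP.
  do 2![apply: run_seq; apply: run_iset]; apply: run_seq; apply: run_iset.
  rewrite /= /upd /= !(E4 14%N isT, E4 1%N isT) kE free4 (E4 0%N isT) (E2 1%N isT) n2.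
  rewrite -/(num_free n (JE m) k) -/(full k) -/(deficit k).
  set m5 := Memory _ _.
  pose I' y m' := [/\ forall k', (k' < k)%N ->
      [/\ forall j, (j < n)%N -> uE m' k' j = initial_row k' j, uE m' k' n = 0%N
        & imem m' 7%N k' 0%N = deficit k'],
    forall j, (j < y)%N -> uE m' k j = initial_row k j, uE m' k n = 0%N,
    imem m' 7%N k 0%N = deficit k
    & forall j, (j < n)%N ->
       NE m' j = (\sum_(k' < k) initial_row k' j +
                  (if (j < y)%N then initial_row k j else 0))%N].
  eapply run_impl.
    apply: (run_for_const (x := n) (I := I')) => //.
    + by move=> m' F /=; rewrite (F.1 0%N isT) /= (E4 0%N isT).
    + rewrite /I' /m5 /= /upd /=; split=> //.
      * move=> k' lt_k'; have [h1 h2 h3] := rows2 k' lt_k'.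
        by rewrite !(ltn_eqF lt_k') /= !(E4 4%N isT, E4 7%N isT).
      * by rewrite !eqxx.
      * by rewrite !eqxx.
      * by move=> j lt_j; rewrite addn0 (E4 6%N isT) N2.
    move=> j m6 lt_j F6 jE [h1 h2 h3 h4 h5].
    have E6 a : a \in [:: 3; 14; 16]%N -> imem m6 a = imem m5 a.
      by move=> aP; rewrite F6.1 //; move: a aP; exact/allP.
    have kE6 : ivar m6 14 = k by rewrite E6 //= (E4 14%N isT).
    have fE6 : ivar m6 16 = full k by rewrite E6.
    have JE6 : JE m6 = JE m by rewrite E6 //= (E4 3%N isT) E2.
    apply: run_seq; apply: run_iset; apply: run_iset.
    rewrite /I' /= /upd /= kE6 fE6 jE JE6 !eqxx /=; split.
    + move=> k' lt_k'; have [g1 g2 g3] := h1 k' lt_k'.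
      by rewrite (ltn_eqF lt_k').
    + move=> x; rewrite ltnS leq_eqVlt; case: eqP => [->|_] //= lt_x.
      exact: h2.
    + by rewrite (gtn_eqF lt_j).
    + by [].
    move=> x lt_x; rewrite ltnS andbT; case: (ltngtP x j) => [lt_xj|gt_xj|xE].
    + by rewrite h5 // lt_xj.
    + by rewrite h5 // ltnNge (ltnW gt_xj).
    + by rewrite h5 // ltnn addn0 /initial_row xE.
  move=> m6 F6 [h1 h2 h3 h4 h5]; split.
  + move=> k'; rewrite ltnS leq_eqVlt => /orP[/eqP->|/h1//]; split=> //.
  + by move=> j lt_j; rewrite big_ord_recr /= -[LHS]/(imem m6 6%N j 0%N) h5 // lt_j.
- by rewrite /=; nia.
Qed.

Lemma run_init_prices :
  run orc init_prices m (100 * n.+1)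
    (fun m' => forall j, (j < n)%N -> qE m' j = muE m j (NE m j).-1).
Proof.
eapply run_le.
  apply: (run_for_const (x := n)
    (I := fun y m' => forall j, (j < y)%N -> qE m' j = muE m j (NE m j).-1)) => //.
    by move=> m' F /=; rewrite (F.1 0%N isT).
  move=> y m' lt_y F yE Iy; apply: run_rset => j /=.
  rewrite /upd /= yE andbT ltnS leq_eqVlt.
  case: (eqVneq j y) => [-> _|_ /= lt_j]; last exact: Iy.
  by rewrite /muE (F.1 21%N isT) (F.1 6%N isT) subn1.
by rewrite /=; lia.
Qed.

(** If the allowed items number exactly [rE m k], then [w] must take them all, as the filled row
    does. Otherwise the difference is at least 1 and the row can pay for its [rE m k]
    augmentations. *)
Lemma full_row w B : feasible_rows n K (JE m) (rE m) B w ->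
  forall k, (k < K)%N ->
    (\sum_(j < n) initial_row k j + deficit k = rE m k)%N /\
    (deficit k <= rE m k * (num_free n (JE m) k - rE m k))%N /\
    forall j, (j < n)%N -> (initial_row k j <= w k j)%N.
Proof.
move=> [al rows _] k lt_k.
have w_le (j : 'I_n) : (w k j <= 1 - JE m k j)%N.
  have [le1 Jk] := al k j lt_k (ltn_ord j).
  by case: posnP Jk => [->//|_ /(_ isT) ->].
have r_le : (rE m k <= num_free n (JE m) k)%N by rewrite -rows //; apply: leq_sum.
rewrite /initial_row -big_distrr /= -/(num_free n (JE m) k) /deficit /full.
have [fE|lt_r] := eqVneq (num_free n (JE m) k) (rE m k).
  rewrite fE !subnn subn0 mul0n addn0 mul1n; split=> //; split=> // j lt_j.
  have : (\sum_(i < n) w k i = \sum_(i < n) (1 - JE m k i))%N by rewrite rows.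
  pose j' := Ordinal lt_j; rewrite (bigD1 j') //= [in RHS](bigD1 j') //= mul1n => E.
  have : (\sum_(i < n | i != j') w k i <= \sum_(i < n | i != j') (1 - JE m k i))%N.
    by apply: leq_sum.
  move: E; move: (\sum_(i < n | i != j') w k i)%N => a.
  by move: (\sum_(i < n | i != j') (1 - JE m k i))%N => b; lia.
have f0 : (1 - (num_free n (JE m) k - rE m k) = 0)%N by lia.
rewrite f0 subn0 mul0n mul1n add0n; split=> //; split; last by move=> j; rewrite mul0n.
by rewrite leq_pmulr //; lia.
Qed.
End Fill.

Lemma matched_eq d d' m : (forall k, (k < KE m)%N -> d k = d' k) ->
  matched d m -> matched d' m.
Proof.
move=> dE [h1 h2 h3 h4 h5]; split=> // k lt_k; rewrite h5 //; exact: dE.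
Qed.

Lemma run_assign w m :
  feasible_rows (nE m) (KE m) (JE m) (rE m) (BE m) w ->
  (forall j x, (j < nE m)%N -> (x.+1 < BE m j)%N -> muE m j x.+1 <= muE m j x) ->
  run orc assign m
    (5000 * ((nE m).+1 ^ 3 * (KE m).+1) * (\sum_(k < KE m) deficit m k).+1)
    (matched (rE m)).
Proof.
move=> wP conc; have [wal wrow wcol] := wP; have fr := full_row wP.
set X := ((nE m).+1 ^ 3 * (KE m).+1)%N.
pose d0 k := (rE m k - deficit m k)%N.
(* Row sums when the rows before [k] are complete and row [k] has had [t] augmentations. *)
pose prog k t x := (d0 x + (if (x < k)%N then deficit m x else if x == k then t else 0))%N.
eapply run_le.
- apply: run_seq; eapply run_impl; first exact: (run_fill m).
  move=> m1 F1 [rows1 N1]; apply: run_seq.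
  have E1 a : a \in [:: 0; 1; 3; 5; 21]%N -> imem m1 a = imem m a.
    by move=> aP; rewrite F1.1 //; move: a aP; exact/allP.
  have mu1 : muE m1 = muE m by rewrite /muE !E1.
  have ip := run_init_prices m1; rewrite mu1 (E1 0%N isT) in ip.
  eapply run_impl; first exact: ip.
  move=> m2 F2 q2.
  have E2 a : a \in [:: 0; 1; 3; 5; 21]%N -> imem m2 a = imem m a.
    by move=> aP; rewrite F2.1 ?E1 //; move: a aP; exact/allP.
  have mu2 : muE m2 = muE m by rewrite /muE !E2.
  have u2 k j : (k < KE m)%N -> (j < nE m)%N -> uE m2 k j = initial_row m k j.
    by move=> lt_k lt_j; rewrite (F2.1 4%N isT); have [uj _ _] := rows1 k lt_k; apply: uj.
  have u2n k : (k < KE m)%N -> uE m2 k (nE m) = 0%N.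
    by move=> lt_k; rewrite (F2.1 4%N isT); have [_ -> _] := rows1 k lt_k.
  have N2 j : (j < nE m)%N -> NE m2 j = (\sum_(k < KE m) initial_row m k j)%N.
    by move=> lt_j; rewrite (F2.1 6%N isT) N1.
  have mat2 : matched d0 m2.
    rewrite /matched mu2 !(E2 0%N isT, E2 3%N isT, E2 5%N isT); split.
    + split=> // k j lt_k; rewrite leq_eqVlt => /orP[/eqP->|lt_j].
        by rewrite u2n // ltnn.
      have [_ [_ /(_ j lt_j) le_w]] := fr k lt_k.
      have [w1 wJ] := wal k j lt_k lt_j.
      rewrite u2 //; split=> [|_ upos]; first exact: leq_trans w1.
      by apply: wJ; apply: leq_trans le_w.
    + move=> k i j lt_k; rewrite leq_eqVlt => /orP[/eqP->|lt_i] lt_j.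
        by rewrite u2n.
      (* A row that holds an item has been filled, so it lacks no allowed item and the condition is
         vacuous. *)
      rewrite !u2 // /initial_row muln_gt0 => /andP[fpos _] + Jj.
      by rewrite Jj subn0 muln1 => f0; rewrite f0 in fpos.
    + move=> j lt_j; split.
      * rewrite N2 //; apply: leq_trans (wcol j lt_j); apply: leq_sum => k _.
        by have [_ [_]] := fr k (ltn_ord k); apply.
      (* The price is the marginal revenue at [N - 1], which concavity puts above the one at [N]; at
         load 0 they coincide. *)
      * rewrite q2 // -(F2.1 6%N isT) => lt_N.
        have [->|Npos] := posnP (NE m2 j); first exact: lexx.
        by rewrite -{1}(prednK Npos); apply: conc; rewrite ?prednK.
      * by rewrite q2 // -(F2.1 6%N isT).
    + by move=> j lt_j; rewrite N2 //; apply: eq_bigr => k _; rewrite u2.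
    + move=> k lt_k; rewrite /d0; have [<- _] := fr k lt_k.
      by rewrite addnK; apply: eq_bigr => j _; rewrite u2.
  have D2 k : (k < KE m)%N -> imem m2 7%N k 0%N = deficit m k.
    by move=> lt_k; rewrite (F2.1 7%N isT); have [_ _ ->] := rows1 k lt_k.
  apply: (run_impl (Q := matched (prog (KE m) 0%N))).
    apply: (run_for (x := KE m) (I := fun k => matched (prog k 0%N))
      (T := fun k => (deficit m k * (4500 * X + (15 + 5)) + (12 + 5))%N)) => //.
    + by move=> m' F /=; rewrite (F.1 0%N isT) (E2 0%N isT).
    + apply: (@matched_eq d0 _ (ivar_set m2 11 0)) => // k _; rewrite /prog ltn0.
      by case: eqP; rewrite addn0.
    move=> k m3 lt_k F3 kE mat3.
    eapply run_impl.
      apply: (run_for_const (x := deficit m k) (I := fun t => matched (prog k t))) => //.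
      + by move=> m' F /=; rewrite (F.1 11%N isT) kE (F.1 7%N isT) (F3.1 7%N isT) D2.
      move=> t m4 lt_t F4 tE mat4.
      have E4 a : a \in [:: 0; 1; 3; 5; 21]%N -> imem m4 a = imem m a.
        by move=> aP; rewrite F4.1 ?F3.1 ?E2 //; move: a aP; exact/allP.
      have k4 : ivar m4 11 = k by rewrite (F4.1 11%N isT).
      have mu4 : muE m4 = muE m by rewrite /muE !E4.
      have au := run_augment (w := w) mat4.
      rewrite mu4 k4 !(E4 0%N isT, E4 1%N isT, E4 3%N isT, E4 5%N isT) in au.
      have prog_le x : (x < KE m)%N -> (prog k t x <= rE m x)%N.
        move=> lt_x; have [<- _] := fr x lt_x; rewrite /prog /d0.
        have [/esym rx _] := fr x lt_x; rewrite rx addnK leq_add2l.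
        by case: ltngtP => // ->; apply: ltnW.
      eapply run_impl; first apply: au => //.
        have [rk _] := fr k lt_k; rewrite /prog /d0 -rk addnK ltnn eqxx.
        by rewrite ltn_add2l.
      move=> m5 _; apply: matched_eq => x _; rewrite /prog -addnA; congr addn.
      by case: ltngtP => _; rewrite ?addn0 ?addn1.
    move=> m4 _; apply: matched_eq => x _; rewrite /prog ltnS; congr addn.
    by case: ltngtP => // [gt_x|->]; rewrite ?(gtn_eqF gt_x) //; case: eqP.
  move=> m' F; apply: matched_eq => k; rewrite (F.1 0%N isT) (E2 0%N isT) => lt_k.
  by rewrite /prog lt_k /d0; have [<- _] := fr k lt_k; rewrite addnK.
- rewrite big_split /= -big_distrl /= sum_nat_const card_ord.
  move: (\sum_(k < _) _)%N => D.
  have X1 : ((nE m).+1 * (KE m).+1 <= X)%N.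
    by rewrite /X leq_mul2r expnS leq_pmulr ?orbT // expn_gt0.
  have : ((nE m).+1 <= X)%N by apply: leq_trans X1; rewrite leq_pmulr.
  have : ((KE m).+1 <= X)%N by apply: leq_trans X1; rewrite leq_pmull.
  move: (X) X1 => Y; rewrite /= => X1 X2 X3.
  have Y0 : (0 < Y)%N by apply: leq_trans X2.
  have DY : (D <= D * Y)%N by rewrite leq_pmulr.
  have -> : (5000 * Y * D.+1 = 5000 * Y + 5000 * (D * Y))%N.
    by rewrite mulnS -!mulnA [(Y * D)%N]mulnC.
  have -> : (D * (4500 * Y + (15 + 5)) = 4500 * (D * Y) + 20 * D)%N.
    by rewrite mulnDr mulnCA [(D * _)%N in X in (_ + X)%N]mulnC.
  move: DY; move: (D * Y)%N => Z; move: X1. lia.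
Qed.

(** * The two runs of the assignment method *)

Lemma run_copy_column a b m : b != a -> b != 0%N -> b != 13%N -> a != 13%N ->
  run orc (copy_column a b) m (100 * (nE m).+1)
    (fun m' => forall j, (j < nE m)%N -> imem m' b j 0%N = imem m a j 0%N).
Proof.
move=> ba b0 b13 a13; have out x : x != b -> x != 13%N -> x \notin iwrites (copy_column a b).
  by move=> xb x13; rewrite /= !inE !negb_or xb x13.
eapply run_le.
  apply: (run_for_const (x := nE m)
    (I := fun y m' => forall j, (j < y)%N -> imem m' b j 0%N = imem m a j 0%N)) => //.
  - by rewrite /= inE eq_sym.
  - by move=> m' F /=; rewrite F.1 // out // eq_sym.
  move=> y m' lt_y F yE Iy; apply: run_iset => j.
  rewrite /= /upd /= yE (negbTE b13) !eqxx /= andbT ltnS leq_eqVlt /=.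
  rewrite F.1; last by rewrite out // eq_sym.
  by case: (eqVneq j y) => [-> //|_ /= lt_j]; apply: Iy.
by rewrite /=; lia.
Qed.

Lemma run_copy_costs m :
  run orc copy_costs m (100 * ((nE m).+1 * (KE m).+1))
    (fun m' => forall k j, (k < KE m)%N -> (j < nE m)%N ->
       cE m' k j = rmem m 0%N k j).
Proof.
pose I y z m' := forall k j, (k < KE m)%N -> (j < nE m)%N ->
  (k < y)%N || (k == y) && (j < z)%N -> cE m' k j = rmem m 0%N k j.
eapply run_le; first apply: (run_impl (Q := I (KE m) 0%N)).
- apply: (run_for_const (x := KE m) (I := fun y => I y 0%N)) => //.
  + by move=> m' F /=; rewrite (F.1 0%N isT).
  + by move=> k j _ _; rewrite !ltn0 andbF.
  move=> y m1 lt_y F1 yE I1; eapply run_impl.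
    apply: (run_for_const (x := nE m) (I := I y)) => //.
    + by move=> m' F /=; rewrite (F.1 0%N isT) (F1.1 0%N isT).
    move=> z m2 lt_z F2 zE I2; apply: run_rset => k j lt_k lt_j.
    rewrite /= /upd /= zE (F2.1 14%N isT) yE (F2.2 0%N isT) (F1.2 0%N isT).
    case: (eqVneq k y) => [->|ne] /=; last first.
      by rewrite orbF => lt_ky; apply: I2; rewrite ?lt_ky.
    rewrite ltnn /= ltnS leq_eqVlt; case: (eqVneq j z) => [->//|_ /= lt_jz].
    by apply: I2; rewrite // eqxx lt_jz orbT.
  move=> m2 _ I2 k j lt_k lt_j; rewrite andbF orbF ltnS leq_eqVlt => le_k.
  by apply: I2; rewrite // lt_j andbT orbC.
- by move=> m' _ H k j lt_k lt_j; apply: H; rewrite // lt_k.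
- by rewrite /=; nia.
Qed.

(** Optimality of the loads comes from the first run, the prices and final rows from the second; the
    two fit together because they have equal loads. *)
Lemma run_bilevel_solver m w :
  (forall k j, cE m k j = 0) ->
  feasible_rows (nE m) (KE m) (JE m) (rE m) (fun j => imem m 2%N j 0%N) w ->
  (forall j x, (j < nE m)%N -> (x.+1 < imem m 2%N j 0%N)%N ->
     orc j x.+2%:R - orc j x.+1%:R <= orc j x.+1%:R - orc j x%:R) ->
  run orc bilevel_solver m
    (4 * (5000 * ((nE m).+1 ^ 3 * (KE m).+1 * (\sum_(k < KE m) deficit m k).+1)))
    (fun m' => [/\
       feasible_rows (nE m) (KE m) (JE m) (rE m) (fun j => imem m 2%N j 0%N) (uE m'),
       priced (nE m) (KE m) (JE m) (rmem m 0%N) (uE m') (qE m')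
     & forall w',
         feasible_rows (nE m) (KE m) (JE m) (rE m) (fun j => imem m 2%N j 0%N) w' ->
         \sum_(j < nE m) orc j (\sum_(k < KE m) w' k j)%N%:R <=
         \sum_(j < nE m) orc j (\sum_(k < KE m) uE m' k j)%N%:R]).
Proof.
move=> c0 wP conc.
eapply run_le.
- apply: run_seq; eapply run_impl; first exact: (@run_copy_column 2 5 m).
  move=> m1 F1 B1; apply: run_seq; apply: run_iset; apply: run_seq.
  rewrite [ieval _ _]/= [ieval _ (ILit 1)]/=.
  set m2 := Memory _ _.
  have E2 a : a \in [:: 0; 1; 2; 3]%N -> imem m2 a = imem m a.
    by move=> aP; rewrite /= upd_neq ?F1.1 //; move: a aP; exact/allP.
  have B2 j : (j < nE m)%N -> BE m2 j = imem m 2%N j 0%N by apply: B1.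
  have mu2 j x : muE m2 j x = orc j (x + 1)%:R - orc j x%:R.
    by rewrite /muE /= /upd /= mul1r.
  have wP2 : feasible_rows (nE m) (KE m) (JE m) (rE m) (BE m2) w.
    by case: wP => h1 h2 h3; split=> // j lt_j; rewrite B2 ?h3.
  have conc2 j x : (j < nE m)%N -> (x.+1 < BE m2 j)%N -> muE m2 j x.+1 <= muE m2 j x.
    by move=> lt_j; rewrite B2 // !mu2 !addn1; apply: conc.
  have df2 : deficit m2 = deficit m.
    by rewrite /deficit /full /num_free !(E2 0%N isT, E2 1%N isT, E2 3%N isT).
  have as2 := run_assign (w := w) (m := m2).
  rewrite df2 !(E2 0%N isT, E2 1%N isT, E2 3%N isT) in as2.
  eapply run_impl; first exact: (as2 wP2 conc2).
  move=> m3 F3 mat3.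
  have E3 a : a \in [:: 0; 1; 2; 3]%N -> imem m3 a = imem m a.
    by move=> aP; rewrite F3.1 ?E2 //; move: a aP; exact/allP.
  have mu3 : muE m3 = muE m2 by rewrite /muE (F3.1 21%N isT).
  move: mat3; rewrite /matched mu3 !(E3 0%N isT, E3 3%N isT) (F3.1 5%N isT).
  move=> [[al3 _] pr3 ba3 N3 row3].
  apply: run_seq; have cc3 := @run_copy_column 6 5 m3; rewrite (E3 0%N isT) in cc3.
  eapply run_impl; first exact: cc3.
  move=> m4 F4 B4; apply: run_seq; apply: run_iset; apply: run_seq.
  rewrite [ieval _ _]/=.
  set m5 := Memory _ _.
  have E5 a : a \in [:: 0; 1; 2; 3]%N -> imem m5 a = imem m a.
    by move=> aP; rewrite /= upd_neq ?F4.1 ?E3 //; move: a aP; exact/allP.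
  have co5 := run_copy_costs m5; rewrite !(E5 0%N isT) in co5.
  eapply run_impl; first exact: co5.
  move=> m6 F6 c6.
  have E6 a : a \in [:: 0; 1; 2; 3]%N -> imem m6 a = imem m a.
    by move=> aP; rewrite F6.1 ?E5 //; move: a aP; exact/allP.
  have B6 j : (j < nE m)%N -> BE m6 j = NE m3 j.
    by move=> lt_j; rewrite (F6.1 5%N isT); apply: B4.
  have rho6 : rmem m5 0%N = rmem m 0%N.
    by rewrite /= (F4.2 0%N isT) (F3.2 0%N isT) /= (F1.2 0%N isT).
  have df6 : deficit m6 = deficit m.
    by rewrite /deficit /full /num_free !(E6 0%N isT, E6 1%N isT, E6 3%N isT).
  have mu6 j x : muE m6 j x = 0 by rewrite /muE (F6.1 21%N isT) /= /upd /= mul0r.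
  (* The rows of the first run witness feasibility of the second, whose bounds are their loads. *)
  have wP6 : feasible_rows (nE m) (KE m) (JE m) (rE m) (BE m6) (uE m3).
    split=> [k j lt_k lt_j|k lt_k|j lt_j].
    + by have [h1 h2] := al3 k j lt_k (ltnW lt_j); split=> // /h2; apply.
    + exact: row3.
    + by rewrite B6 // N3.
  have as6 := run_assign (w := uE m3) (m := m6).
  rewrite df6 !(E6 0%N isT, E6 1%N isT, E6 3%N isT) in as6.
  eapply run_impl; first by apply: (as6 wP6) => j x _ _; rewrite !mu6.
  move=> m7 F7.
  have E7 a : a \in [:: 0; 1; 2; 3]%N -> imem m7 a = imem m a.
    by move=> aP; rewrite F7.1 ?E6 //; move: a aP; exact/allP.
  rewrite /matched !(E7 0%N isT, E7 1%N isT, E7 3%N isT) (F7.1 5%N isT) (F7.2 2%N isT).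
  move=> [[al7 dum7] pr7 ba7 N7 row7].
  have le_73 j : (j < nE m)%N -> (NE m7 j <= NE m3 j)%N.
    by move=> lt_j; have [le_B _ _] := ba7 j lt_j; rewrite -B6.
  have eq_73 j : (j < nE m)%N -> NE m7 j = NE m3 j.
    (* Both loads sum to the total of the [rE m k], so loads bounded by the first ones must equal
       them. *)
    have total (v : nat -> nat) (u : nat -> nat -> nat) :
        (forall j, (j < nE m)%N -> v j = \sum_(k < KE m) u k j)%N ->
        (forall k, (k < KE m)%N -> \sum_(j < nE m) u k j = rE m k)%N ->
        (\sum_(j < nE m) v j = \sum_(k < KE m) rE m k)%N.
      move=> vE uE; rewrite (eq_bigr (fun j : 'I_(nE m) => \sum_(k < KE m) u k j)%N).
        by rewrite exchange_big; apply: eq_bigr => k _; apply: uE.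
      by move=> i _; apply: vE.
    have tot : (\sum_(i < nE m) NE m7 i = \sum_(i < nE m) NE m3 i)%N.
      by rewrite (total _ _ N7 row7) (total _ _ N3 row3).
    move=> lt_j; apply/eqP; rewrite eqn_leq le_73 //=.
    pose j' := Ordinal lt_j; move: tot; rewrite (bigD1 j') //= [in RHS](bigD1 j') //=.
    have : (\sum_(i < nE m | i != j') NE m7 i <= \sum_(i < nE m | i != j') NE m3 i)%N.
      by apply: leq_sum => i _; apply: le_73.
    move: (\sum_(i < nE m | i != j') NE m7 i)%N => a.
    by move: (\sum_(i < nE m | i != j') NE m3 i)%N => b; lia.
  split.
  + split=> [k j lt_k lt_j|k lt_k|j lt_j].
    * by have [h1 h2] := al7 k j lt_k (ltnW lt_j); split=> // /h2; apply.
    * by rewrite row7.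
    * by rewrite -N7 // eq_73 // -B2 //; have [] := ba3 j lt_j.
  + move=> k i j lt_k; rewrite leq_eqVlt => /orP[/eqP->|lt_i] lt_j.
      by rewrite dum7.
    have := pr7 k i j lt_k (ltnW lt_i) lt_j.
    by rewrite !c6 // rho6.
  + move=> w' wP'.
    have wP3 : feasible_rows (nE m) (KE m) (JE m) (rE m) (BE m2) w'.
      by case: wP' => h1 h2 h3; split=> // j lt_j; rewrite B2 ?h3.
    have mu_h j x : muE m2 j x = orc j x.+1%:R - orc j x%:R by rewrite mu2 addn1.
    have c3 k j : cE m3 k j = 0 by rewrite (F3.2 2%N isT) /= (F1.2 2%N isT).
    have := priced_optimal (h := fun j x => orc j x%:R) c3 conc2 mu_h al3 pr3 ba3 N3 row3 wP3.
    move/le_trans; apply; rewrite le_eqVlt; apply/orP; left; apply/eqP.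
    by apply: eq_bigr => j _; rewrite -N7 // eq_73.
- set X := ((nE m).+1 ^ 3 * (KE m).+1)%N; set D := (\sum_(k < _) _).+1%N.
  have : ((nE m).+1 * (KE m).+1 <= X * D)%N.
    by rewrite /X mulnAC leq_mul2r expnS -mulnA leq_pmulr ?orbT // muln_gt0 expn_gt0.
  have : ((nE m).+1 <= (nE m).+1 * (KE m).+1)%N by rewrite leq_pmulr.
  rewrite -!mulnA; move: (_.+1 * _.+1)%N => W; move: (X * D)%N => Y; rewrite /=; lia.
Qed.
End Specification.

(** * Encoding of the instance *)

Lemma ext1E (T : Type) (x0 : T) (p : nat) (g : 'I_p -> T) (i : 'I_p) :
  ext1 x0 g i = g i.
Proof. by rewrite /ext1 valK. Qed.

(** The second difference of [x * s x] is [x] times that of [s], plus [2 * (s (x + 2) - s (x + 1))].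
    The first term is nonpositive by midpoint concavity, the second by monotonicity. *)
Lemma revenue_concave (R : realType) (n : nat) (NC : 'I_n -> nat)
    (s : 'I_n -> R -> R) (i : 'I_n) (x : nat) :
  {in `[0, (NC i)%:R] &, {homo s i : x z / x <= z >-> z <= x}} ->
  convex_function (E := R^o) `[0, (NC i)%:R]%classic (fun x => - s i x) ->
  (x.+1 < NC i)%N ->
  revenue s i x.+2%:R - revenue s i x.+1%:R <=
  revenue s i x.+1%:R - revenue s i x%:R.
Proof.
move=> mono conv lt_x.
have inD (y : nat) : (y <= NC i)%N -> y%:R \in (`[0, (NC i)%:R] : interval R).
  by move=> le_y; rewrite in_itv /= ler0n ler_nat.
have s12 : s i x.+2%:R <= s i x.+1%:R.
  by apply: mono; rewrite ?inD ?ler_nat //; lia.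
have half0 : 0 <= (2^-1 : R) by rewrite invr_ge0.
have half1 : (2^-1 : R) <= 1 by rewrite invf_le1 ?ler1n.
have midE : convex.conv (Itv01 half0 half1) (x%:R : R^o) (x.+2%:R : R^o) = x.+1%:R.
  by rewrite convRE /= /unstable.onem -!natr1; field.
have mid : - s i x.+1%:R <= 2^-1 * - s i x%:R + (1 - 2^-1) * - s i x.+2%:R.
  by rewrite -midE; apply: conv; rewrite inE; apply: inD; lia.
have {}mid : s i x%:R + s i x.+2%:R <= s i x.+1%:R + s i x.+1%:R by lra.
have x0 : 0 <= x%:R :> R by rewrite ler0n.
have := ler_wpM2l x0 mid; rewrite /revenue.
move: s12 {mid midE}; move: (s i x%:R) (s i x.+1%:R) (s i x.+2%:R) => a b c.
rewrite -!natr1; move: (x%:R) x0 => X x0 le_cb le_mid; lra.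
Qed.

Section Encoding.
Variables (R : realType) (n K : nat) (J : 'I_K -> {set 'I_n}) (r : 'I_K -> nat).
Variables (rho : 'I_K -> 'I_n -> \bar R) (NC : 'I_n -> nat).
Let m0 := input_memory J r rho NC.

Definition of_rows (U : 'I_K -> {ffun 'I_n -> bool}) : nat -> nat -> nat :=
  ext2 0%N (fun k i => U k i : nat).

Lemma of_rowsE U (k : 'I_K) (i : 'I_n) : of_rows U k i = U k i.
Proof. by rewrite /of_rows /ext2 !ext1E. Qed.

Lemma input_JE (k : 'I_K) (i : 'I_n) : imem m0 3%N k i = (i \in J k).
Proof. by rewrite /= /ext2 !ext1E. Qed.

Lemma input_rE (k : 'I_K) : imem m0 1%N k 0%N = r k.
Proof. by rewrite /= /column /= ext1E. Qed.

Lemma input_NCE (i : 'I_n) : imem m0 2%N i 0%N = NC i.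
Proof. by rewrite /= /column /= ext1E. Qed.

Lemma input_rhoE (k : 'I_K) (i : 'I_n) : rmem m0 0%N k i = fine (rho k i).
Proof. by rewrite /= /ext2 !ext1E. Qed.

Lemma feasible_rows_of U :
  (forall k, lower_set (J k) (r k) (U k)) -> (forall i, (load U i <= NC i)%N) ->
  feasible_rows n K (imem m0 3%N) (fun k => imem m0 1%N k 0%N)
    (fun i => imem m0 2%N i 0%N) (of_rows U).
Proof.
move=> lowU loadU; split=> [k i lt_k lt_i|k lt_k|i lt_i].
- rewrite -[k]/(nat_of_ord (Ordinal lt_k)) -[i]/(nat_of_ord (Ordinal lt_i)).
  rewrite of_rowsE input_JE; split; first by case: (U _ _).
  have /andP[_ /forall_inP UJ] := lowU (Ordinal lt_k).
  by case: (boolP (Ordinal lt_i \in _)) => // /UJ /negbTE ->.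
- rewrite -[k]/(nat_of_ord (Ordinal lt_k)) input_rE.
  have /andP[/eqP <- _] := lowU (Ordinal lt_k).
  by apply: eq_bigr => i _; rewrite of_rowsE.
- rewrite -[i]/(nat_of_ord (Ordinal lt_i)) input_NCE.
  apply: leq_trans (loadU (Ordinal lt_i)).
  by apply: leq_sum => k _; rewrite of_rowsE.
Qed.

Lemma deficit_sum_le w :
  feasible_rows n K (imem m0 3%N) (fun k => imem m0 1%N k 0%N)
    (fun i => imem m0 2%N i 0%N) w ->
  (\sum_(k < K) deficit m0 k <= Rbar J r)%N.
Proof.
move=> wP; apply: leq_sum => k _; have [_ [le_d _]] := full_row (m := m0) wP (ltn_ord k).
apply: leq_trans le_d _; rewrite input_rE leq_mul2l; apply/orP; right.
apply: leq_sub2r; rewrite /num_free /nfree.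
have -> : (\sum_(j < n) (1 - imem m0 3 k j) = \sum_(j < n | j \notin J k) 1)%N.
  rewrite [RHS]big_mkcond; apply: eq_bigr => j _.
  by rewrite input_JE; case: (j \in J k).
by rewrite sum1_card -[X in (_ <= X - _)%N]card_ord -(cardC (mem (J k))) addKn.
Qed.

(** Each entry of [rho] takes at least one symbol. *)
Lemma input_size_ge : (K * n <= input_size r rho NC)%N.
Proof.
have size_pos (x : \bar R) : (0 < ereal_size x)%N.
  case: x => [x| |] //=; rewrite /real_size.
  by case: pselect => // q; rewrite /rat_size.
rewrite /input_size; apply: leq_trans (leq_addr _ _).
apply: leq_trans (leq_addl _ _).
rewrite -[X in (X * n)%N]card_ord -sum_nat_const; apply: leq_sum => k _.
apply: leq_trans (leq_addl _ _).
rewrite -[X in (X <= _)%N]card_ord -sum1_card.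
exact: leq_sum.
Qed.

End Encoding.

(** A member of the lower-level set vanishes on [J], so infinite entries meet only the factor 0 and
    may be replaced by the 0 of the encoding. *)
Lemma scal_fin (R : realType) (n : nat) (J : {set 'I_n}) (r : nat)
    (rho : 'I_n -> \bar R) (y : 'I_n -> R) (u : {ffun 'I_n -> bool}) :
  (forall i, rho i <> +oo%E) -> (forall i, rho i = -oo%E <-> i \in J) ->
  lower_set J r u ->
  scal (fun i => (rho i + (y i)%:E)%E) u =
  (\sum_(i < n) (u i)%:R * (fine (rho i) + y i))%:E.
Proof.
move=> pinf minf /andP[_ /forall_inP uJ]; rewrite /scal -sumEFin.
apply: eq_bigr => i _; case: (boolP (u i)) => ui; last by rewrite mule0 mul0r.
have := pinf i; have := minf i; case: (rho i) => [x| |] // ninf _.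
  by rewrite mule1 mul1r.
by have /uJ := ninf.1 erefl; rewrite ui.
Qed.

(** Since [n ^ 2 * D.+1] is at most the cube of [n + Rb], and [K * n] at most [L], the count is of
    order [(n + Rb) ^ 3 * L]; the exponent is then raised to 7/2. The factor 16 comes from
    [n.+1 <= 2 * n], cubed, and [K.+1 <= 2 * K]. *)
Lemma step_bound (R : realType) (n K D Rb L t : nat) :
  (1 <= n)%N -> (1 <= K)%N -> (D <= Rb)%N -> (K * n <= L)%N ->
  (t <= 4 * (5000 * (n.+1 ^ 3 * K.+1 * D.+1)))%N ->
  (t%:R : R) <= (4 * (5000 * 16))%N%:R * ((n + Rb)%:R `^ (7 / 2) * L%:R).
Proof.
move=> n1 K1 D_le L_ge t_le; set x := (n + Rb)%N.
have x1 : (1 <= x)%N by rewrite addn_gt0 n1.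
have bound : (t <= 4 * (5000 * 16) * (x ^ 3 * L))%N.
  have n3 : (n.+1 ^ 3 <= 8 * n ^ 3)%N.
    by rewrite -[8%N]/(2 ^ 3)%N -expnMn leq_exp2r //; lia.
  have KD : (K.+1 * D.+1 <= 2 * K * D.+1)%N by rewrite leq_mul2r; lia.
  have xn : (n ^ 2 * D.+1 <= x ^ 3)%N.
    by rewrite [(x ^ 3)%N]expnSr leq_mul // ?leq_exp2r /x; lia.
  have nE : (8 * n ^ 3 * (2 * K * D.+1) = 16 * (n ^ 2 * D.+1 * (K * n)))%N.
    by rewrite [(n ^ 3)%N]expnSr; move: (n ^ 2)%N => a; nia.
  have : (n ^ 2 * D.+1 * (K * n) <= x ^ 3 * L)%N by apply: leq_mul.
  have := leq_mul n3 KD; rewrite nE mulnA; move: t_le.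
  move: (n.+1 ^ 3 * _ * _)%N (n ^ 2 * _ * _)%N (x ^ 3 * L)%N => a b c; lia.
apply: le_trans (_ : (4 * (5000 * 16) * (x ^ 3 * L))%N%:R <= _); first by rewrite ler_nat.
rewrite natrM ler_wpM2l ?ler0n // natrM ler_wpM2r ?ler0n //.
rewrite natrX -powR_mulrn ?ler0n //; apply: ler_powR; first by rewrite ler1n.
by rewrite ler_pdivlMr // -natrM ler_nat.
Qed.

Theorem theorem3 :
  exists (P : program) (C : nat),
  forall (R : realType) (n K : nat) (J : 'I_K -> {set 'I_n}) (r : 'I_K -> nat)
    (rho : 'I_K -> 'I_n -> \bar R) (NC : 'I_n -> nat) (s : 'I_n -> R -> R),
  (1 <= n)%N -> (1 <= K)%N ->
  (forall k i, rho k i <> +oo%E) ->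
  (forall k i, rho k i = -oo%E <-> i \in J k) ->
  (forall i, {in `[0, (NC i)%:R] &, {homo s i : x z / x <= z >-> z <= x}}) ->
  (forall i, convex_function (E := R^o) `[0, (NC i)%:R]%classic
     (fun x => - s i x)) ->
  (exists U : 'I_K -> {ffun 'I_n -> bool},
     (forall k, lower_set (J k) (r k) (U k)) /\
     (forall i, (load U i <= NC i)%N)) ->
  exists (t : nat) (m : memory R) (y : 'I_n -> R)
    (U : 'I_K -> {ffun 'I_n -> bool}),
  [/\ exec (oracle s) P (input_memory J r rho NC) t m,
      outputs m y U,
      bilevel_optimal J r rho NC s y U
    & (t%:R : R) <=
        C%:R * ((K * n)%:R `^ (7 / 2) * (input_size r rho NC)%:R * n%:R ^+ 3
                  * ln (K%:R / n%:R) ^+ 2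
                + (n + Rbar J r)%:R `^ (7 / 2) * (input_size r rho NC)%:R)].
Proof.
exists bilevel_solver, (4 * (5000 * 16))%N.
move=> R n K J r rho NC s n1 K1 pinf minf mono conv [U0 [low0 load0]].
set m0 := input_memory J r rho NC.
have wP := feasible_rows_of rho low0 load0.
have orcE (i : 'I_n) (x : nat) : oracle s i x%:R = revenue s i x%:R.
  by rewrite /oracle ler0n ext1E.
have concave j x : (j < n)%N -> (x.+1 < imem m0 2%N j 0%N)%N ->
    oracle s j x.+2%:R - oracle s j x.+1%:R <= oracle s j x.+1%:R - oracle s j x%:R.
  move=> lt_j; rewrite -[j]/(nat_of_ord (Ordinal lt_j)) input_NCE !orcE.
  by apply: revenue_concave.
(* The costs of the first run are cells outside the input, hence 0 by computation. *)
have [t [m [ex t_le [rows pr opt]]]] := run_bilevel_solver (orc := oracle s) (m := m0)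
  (fun _ _ => erefl) wP concave.
pose U k : {ffun 'I_n -> bool} := [ffun i : 'I_n => (0 < imem m 4%N k i)%N].
pose y (i : 'I_n) := rmem m 1%N i 0%N.
have [rowal rowsum rowcol] := rows.
have UE (k : 'I_K) (i : 'I_n) : imem m 4%N k i = U k i.
  rewrite ffunE; have [] := rowal k i (ltn_ord k) (ltn_ord i).
  by case: (imem m _ _ _) => [|[]].
have lowU (k : 'I_K) : lower_set (J k) (r k) (U k).
  apply/andP; split.
    rewrite -(input_rE J r rho NC) -rowsum //; apply/eqP.
    by apply: eq_bigr => i _; rewrite UE.
  apply/forall_inP => i iJ; apply/negP => Ui.
  have [_] := rowal k i (ltn_ord k) (ltn_ord i).
  by rewrite UE Ui input_JE iJ => /(_ isT).
have loadE (i : 'I_n) : load (fun k : 'I_K => U k) i = (\sum_(k < K) imem m 4%N k i)%N.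
  by apply: eq_bigr => k _; rewrite UE.
have objE (V : 'I_K -> {ffun 'I_n -> bool}) v :
    (forall i : 'I_n, load V i = \sum_(k < K) v k i)%N ->
    objective s V = \sum_(j < n) oracle s j (\sum_(k < K) v k j)%N%:R.
  by move=> vE; apply: eq_bigr => i _; rewrite -vE orcE.
exists t, m, y, (fun k => U k); split=> //.
- split.
    split=> [i|k].
      by rewrite loadE; apply: leq_trans (rowcol i (ltn_ord i)) _; rewrite input_NCE.
    split=> // z lowz; rewrite (scal_fin y (pinf k) (minf k) lowz).
    rewrite (scal_fin y (pinf k) (minf k) (lowU k)) lee_fin.
    have /andP[/eqP zsum /forall_inP zJ] := lowz.
    pose w := ext1 0%N (fun i => z i : nat).
    have wE (i : 'I_n) : w i = z i by rewrite /w ext1E.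
    have costE (v : nat -> nat) (u : {ffun 'I_n -> bool}) :
        (forall i : 'I_n, v i = u i) ->
        \sum_(i < n) (u i)%:R * (fine (rho k i) + y i) =
        \sum_(i < n) (v i)%:R * (rmem m0 0%N k i + rmem m 1%N i 0%N).
      by move=> vE; apply: eq_bigr => i _; rewrite vE input_rhoE.
    rewrite (costE w z wE) (costE (imem m 4%N k) (U k) (UE k)).
    apply: (priced_le pr) => // [j lt_j|j lt_j|].
    + have [-> _] := rowal k j (ltn_ord k) lt_j.
      by rewrite -[j]/(nat_of_ord (Ordinal lt_j)) wE; split=> //; case: (z _).
    + rewrite -[j]/(nat_of_ord (Ordinal lt_j)) wE input_JE.
      by case: (boolP (Ordinal lt_j \in _)) => // /zJ /negbTE ->.
    + rewrite rowsum // [RHS](eq_bigr (fun i : 'I_n => z i : nat)) ?zsum ?input_rE //.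
  (* The competitor is compared only as a member of the feasible rows; its being a best response to
     [y'] is stronger than that. *)
  move=> y' U' [load' low'].
  rewrite (objE _ _ loadE) (objE U' (of_rows U')); last first.
    by move=> i; apply: eq_bigr => k _; rewrite of_rowsE.
  apply: opt; apply: feasible_rows_of => // k; by have [] := low' k.
- apply: le_trans (step_bound R n1 K1 (deficit_sum_le wP) (input_size_ge r rho NC) t_le) _.
  (* The second summand suffices: the first is nonnegative, its logarithm being squared. *)
  rewrite ler_wpM2l ?ler0n // lerDr.
  by rewrite mulr_ge0 ?sqr_ge0 // !mulr_ge0 ?powR_ge0 ?exprn_ge0 ?ler0n.
Qed.
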